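(* Let $V$ be a finite-dimensional real normed space, $m\ge 1$ an integer and $p\ge 1$ a real number. Then $C^{0,p\text{-}var}(G^{m}(V))$, with the metric $d_{p\text{-}var}$, is separable.
   Context: $T^{(m)}(V)=\bigoplus_{n=0}^{m}V^{\otimes n}$ is the truncated tensor algebra with (truncated) product $\otimes$; $\mathcal{G}^{m}(V)$ is its Lie subalgebra generated by $V$ for the bracket $[a,b]=a\otimes b-b\otimes a$; $G^{m}(V)=\exp(\mathcal{G}^{m}(V))$ is the free nilpotent Lie group of step $m$ over $V$, with product $\otimes$ and neutral element $1$. The dilation is $\delta_{t}(1+v_{1}+\dots+v_{m})=1+tv_{1}+\dots+t^{m}v_{m}$, $v_i\in V^{\otimes i}$, $t\in\mathbb{R}$. $\|\cdot\|_{m}$ is a fixed symmetric subadditive homogeneous norm on $G^{m}(V)$, i.e. a function $G^m(V)\to[0,\infty)$ with $\|g\|_m=0$ iff $g=1$, $\|\delta_t g\|_m=|t|\,\|g\|_m$, $\|g\otimes h\|_m\le\|g\|_m+\|h\|_m$, $\|g^{-1}\|_m=\|g\|_m$ (for instance the Carnot–Caratheodory norm; all such norms are equivalent since $\dim V<\infty$). Set $d_{m}(g,h)=\|g^{-1}\otimes h\|_{m}$. A $G^m(V)$-valued path is a continuous map $[0,1]\to G^{m}(V)$ starting at $1$; for such a path $Y_{s,t}:=Y_{s}^{-1}\otimes Y_{t}$. For a smooth path $y:[0,1]\to V$, the signature is $S_{m}(y)_{s,t}=1+\sum_{k=1}^{m}\int_{s<u_{1}<\dots<u_{k}<t}dy_{u_{1}}\otimes\dots\otimes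 dy_{u_{k}}\in G^{m}(V)$, and $S_m(y)$ denotes the $G^m(V)$-valued path $t\mapsto S_m(y)_{0,t}$. $d_{p\text{-}var}(x,y)=\sup_{D=(0=t_{0}<\cdots<t_{n}=1)}\big(\sum_{i=0}^{n-1}d_{m}(x_{t_{i},t_{i+1}},y_{t_{i},t_{i+1}})^{p}\big)^{1/p}$, and $C^{0,p\text{-}var}(G^{m}(V))$ is the $d_{p\text{-}var}$-closure, in the set of $G^m(V)$-valued paths, of $\{S_{m}(x): x \text{ a smooth } V\text{-valued path}\}$. *)

(* Defs.v *)
From HB Require Import structures.
From mathcomp Require Import all_boot all_order all_algebra.
From mathcomp Require Import all_classical all_reals all_analysis.

Set Implicit Arguments.
Unset Strict Implicit.
Unset Printing Implicit Defensive.

Import Order.TTheory GRing.Theory Num.Theory.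
Import numFieldNormedType.Exports.

Local Open Scope classical_set_scope.
Local Open Scope ring_scope.

(** Finite-dimensional normed spaces: the norm comes from [NormedModule], the
    finite dimension (and a basis) from [Vector]. *)
#[short(type="finNormedModType")]
HB.structure Definition FinNormedModule (R : numDomainType) :=
  {V of NormedModule R V & Vector R V}.

Section TruncatedTensorAlgebra.
Context {R : realType} (V : finNormedModType R) (m : nat).

Definition vcoord (i : 'I_(\dim {:V})) (v : V) : R := coord (vbasis {:V}) i v.

(** The basis of V indexed by ['I_(\dim V)] induces the basis
    e_w = e_{w_1} (x) ... (x) e_{w_n} of V^{(x) n}, w ranging over words of
    length n. An element of T^(m)(V) is the family of its coordinates along the
    e_w, where w is a word of length at most m; degree n is the part supported
    on the words of length n. *)
Definition word : finType := m.-bseq 'I_(\dim {:V}).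
Definition tensor : lmodType R := {ffun word -> R}.

(** e_u (x) e_v = e_{uv}, which is 0 in T^(m)(V) when uv has length > m. *)
Definition tmul (a b : tensor) : tensor :=
  [ffun w : word => \sum_(uv : word * word | uv.1 ++ uv.2 == w :> seq _)
                      a uv.1 * b uv.2].

Definition tone : tensor := [ffun w : word => (size w == 0%N)%:R].

Definition texpn (a : tensor) (k : nat) : tensor := iter k (tmul a) tone.

Definition tvec (v : V) : tensor :=
  [ffun w : word => (if val w is [:: i] then vcoord i v else 0 : R)].

Definition tbracket (a b : tensor) : tensor := tmul a b - tmul b a.

Definition lie_subalgebra : set (set tensor) :=
  [set L : set tensor |
    [/\ L 0,
        forall (c : R) a b, L a -> L b -> L (c *: a + b)
      & forall a b, L a -> L b -> L (tbracket a b)]].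

Definition free_nilpotent_lie : set tensor :=
  smallest lie_subalgebra (range tvec).

(** The series stops at k = m because a^k = 0 for k > m when a has no
    component of degree 0; only such a are used. *)
Definition texp (a : tensor) : tensor :=
  \sum_(k < m.+1) k`!%:R^-1 *: texpn a k.

Definition free_nilpotent_group : set tensor := texp @` free_nilpotent_lie.

(** g^{-1} = sum_{k <= m} (1 - g)^k, the inverse in T^(m)(V) of an element g
    whose component of degree 0 is 1. *)
Definition tinv (g : tensor) : tensor := \sum_(k < m.+1) texpn (tone - g) k.

Definition dilation (t : R) (g : tensor) : tensor :=
  [ffun w : word => t ^+ size w * g w].

(** Symmetric subadditive homogeneous norm on G^m(V); the values of N outside
    G^m(V) are irrelevant. *)
Definition homogeneous_norm (N : tensor -> R) : Prop :=
  let G := free_nilpotent_group in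
  [/\ forall g, G g -> 0 <= N g,
      forall g, G g -> (N g = 0 <-> g = tone),
      forall (t : R) g, G g -> N (dilation t g) = `|t| * N g,
      forall g h, G g -> G h -> N (tmul g h) <= N g + N h
    & forall g, G g -> N (tinv g) = N g].

Definition tdist (N : tensor -> R) (g h : tensor) : R := N (tmul (tinv g) h).

(** Paths on [0, 1] are functions on R of which only the restriction to [0, 1]
    matters. Since T^(m)(V) is finite-dimensional, continuity is continuity of
    all coordinates. *)
Definition Gpath : set (R -> tensor) :=
  [set Y : R -> tensor |
    [/\ forall w : word, {within `[0, 1], continuous (fun t : R => Y t w : R)},
        forall t, t \in `[0, 1] -> free_nilpotent_group (Y t)
      & Y 0 = tone]].

Definition increment (Y : R -> tensor) (s t : R) : tensor :=
  tmul (tinv (Y s)) (Y t).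

(** A smooth path [0, 1] -> V is the restriction of a smooth map R -> V. *)
Definition smooth_path : set (R -> V) :=
  [set y : R -> V | forall n (t : R), derivable (derive1n n y) t 1].

(** int_{s < u_1 < ... < u_k < t} dy^{w_1}_{u_1} ... dy^{w_k}_{u_k} as an
    iterated integral, u_1 being the outermost variable. *)
Fixpoint iterated_integral (y : R -> V) (w : seq 'I_(\dim {:V})) (s t : R) : R :=
  if w is i :: w' then
    \int[lebesgue_measure]_(u in `[s, t])
      (vcoord i (derive1 y u) * iterated_integral y w' u t)
  else 1.

Definition signature (y : R -> V) (s t : R) : tensor :=
  [ffun w : word => iterated_integral y w s t].

(** For the subdivision 0 = t_0 < t_1 < ... < t_n = 1, [D] is the sequence
    t_1, ..., t_n. *)
Definition pvar_sum (N : tensor -> R) (p : R) (X Y : R -> tensor) (D : seq R) : R :=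
  let T := nth 1 (0 :: D) in
  \sum_(0 <= i < size D)
    tdist N (increment X (T i) (T i.+1)) (increment Y (T i) (T i.+1)) `^ p.

Definition pvar_dist (N : tensor -> R) (p : R) (X Y : R -> tensor) : \bar R :=
  ereal_sup [set (pvar_sum N p X Y D `^ p^-1)%:E | D in itv_partition 0 1].

Definition C0pvar (N : tensor -> R) (p : R) : set (R -> tensor) :=
  [set Y : R -> tensor | Gpath Y /\
     forall eps : R, 0 < eps -> exists2 y : R -> V, smooth_path y &
       (pvar_dist N p (signature y 0) Y < eps%:E)%E].

End TruncatedTensorAlgebra.

Definition separable {R : realType} {X : Type} (d : X -> X -> \bar R)
    (A : set X) : Prop :=
  exists2 D : set X, countable D /\ D `<=` A &
    forall x, A x -> forall eps : R, 0 < eps ->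
      exists2 z, D z & (d x z < eps%:E)%E.

(* Main.v *)
Require Import Defs.
From HB Require Import structures.
From mathcomp Require Import all_boot all_order all_algebra.
From mathcomp Require Import all_classical all_reals all_analysis.
From mathcomp Require Import ring lra.

(** Let [D] be the derivation of the truncated tensor algebra multiplying degree
    [n] by [n]. An element [g] with constant term [1] lies in the group iff
    [D g = u g] for some [u] in the Lie algebra; hence the group is closed under
    products, and, Dynkin's right-normed bracketing giving [u] for a signature,
    contains signatures of smooth paths. Since the norm is homogeneous and
    subadditive, [N g <= C t] as soon as [`|g_w| <= t ^ |w|] for all words [w].
    If two smooth paths have velocities bounded by [K] and uniformly close to
    each other on [[0, 1]], this gives [d (Sx_{s,t}, Sy_{s,t}) <= eta (t - s)]
    with [eta] small, so that their signatures are close in [p]-variation because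
    [p >= 1]. Velocities are encoded, up to any precision, by countably many
    values, and choosing for each code an element of the closure near a signature
    with that code yields a countable dense subset. *)

Set Implicit Arguments.
Unset Strict Implicit.
Unset Printing Implicit Defensive.

Import Order.TTheory GRing.Theory Num.Theory.
Import numFieldNormedType.Exports.

Local Open Scope ring_scope.

(** The axioms on [N] speak only of the group and assume no continuity. So every element whose norm
    is estimated must be shown to lie in the group, and the estimate must come from homogeneity,
    subadditivity and symmetry. Exponentials of multiples of one homogeneous bracket are within
    reach: for [b] of degree n, exp(k b) is the dilate by |k|^(1/n) of exp(b) or of its inverse.
    This is why coordinates of degree n are measured against t^n. Dynkin's formula supplies the
    finitely many brackets that suffice, with coefficients controlled by coordinates.

    For signatures, the coordinate of S(x)^{-1} S(y) - 1 along a word of length k is at most a small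
    factor times (K (t - s))^k. Once that factor times K^m is below eta^m, the bound becomes (eta (t
    - s))^k for all k from 1 to m, hence a distance linear in t - s. *)

(** * The truncated tensor product as a ring *)

Section TensorRing.
Context {R : realType} (V : finNormedModType R) (m : nat).
Local Notation letter := 'I_(\dim {:V}).
Local Notation word := (word V m).
Local Notation tensor := (tensor V m).
Implicit Types (a b c : tensor) (u v w : word) (s : seq letter).

Lemma tmulE a b w :
  tmul a b w =
  \sum_(u : word) \sum_(v : word) (u ++ v == w :> seq _)%:R * (a u * b v).
Proof.
rewrite ffunE big_mkcond pair_bigA /=; apply: eq_bigr => -[u v] _ /=.
by case: ifP; rewrite ?mul1r ?mul0r.
Qed.

(** Together with [sum_word_gt] this isolates truncation: an inner sum over words collapses to one
    term, or to none when the concatenation is too long. *)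
Lemma sum_word (F : word -> R) s :
  (size s <= m)%N ->
  \sum_(x : word) (s == x :> seq _)%:R * F x = F (insubd [bseq] s).
Proof.
move=> sm; have E : val (insubd [bseq] s : word) = s by rewrite insubdK.
rewrite (bigD1 (insubd [bseq] s : word)) //= -[X in X == _]E eqxx mul1r.
rewrite big1 ?addr0 // => x xn; case: eqVneq => [e|]; rewrite ?mul0r //.
by rewrite e valKd eqxx in xn.
Qed.

Lemma sum_word_gt (F : word -> R) s :
  (m < size s)%N -> \sum_(x : word) (s == x :> seq _)%:R * F x = 0.
Proof.
move=> sm; rewrite big1 // => x _; case: eqP => [e|]; rewrite ?mul0r //.
by move: sm; rewrite e ltnNge size_bseq.
Qed.

(** Both sides equal the sum over triples of words concatenating to [w]. *)
Lemma tmulA : associative (@tmul R V m).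
Proof.
move=> a b c; apply/ffunP => w.
pose T (u v z : word) := a u * b v * c z.
transitivity (\sum_(u : word) \sum_(v : word) \sum_(z : word)
    (u ++ v ++ z == w :> seq _)%:R * T u v z).
  rewrite tmulE; apply: eq_bigr => u _.
  under eq_bigr => x _ do rewrite tmulE.
  under eq_bigr => x _.
    rewrite mulrA big_distrr /=; over.
  rewrite exchange_big; apply: eq_bigr => v _ /=.
  under eq_bigr => x _ do rewrite big_distrr /=.
  rewrite exchange_big; apply: eq_bigr => z _ /=.
  under eq_bigr => x _ do rewrite mulrCA.
  case: (leqP (size (v ++ z)) m) => vz.
    rewrite sum_word //= insubdK //; rewrite /T; by rewrite !mulrA.
  (* The inner product loses [v ++ z] by truncation, but then [u ++ v ++ z] is too long to be [w] as
     well. *)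
  rewrite sum_word_gt //; case: eqP => [e|]; rewrite ?mul0r //.
  have := size_bseq w; rewrite -e size_cat leqNgt.
  by rewrite (leq_trans vz) // leq_addl.
rewrite [RHS]tmulE [RHS]exchange_big /=.
under eq_bigr => u _ do rewrite exchange_big /=.
rewrite exchange_big; apply: eq_bigr => z _ /=.
under [RHS]eq_bigr => x _ do rewrite tmulE mulrCA big_distrl /=.
rewrite [RHS]exchange_big; apply: eq_bigr => u _ /=.
under [RHS]eq_bigr => x _ do rewrite big_distrl /=.
rewrite [RHS]exchange_big; apply: eq_bigr => v _ /=.
rewrite catA.
transitivity (\sum_(x : word) (u ++ v == x :> seq letter)%:R *
   ((x ++ z == w :> seq _)%:R * T u v z)); last first.
  apply: eq_bigr => x _; rewrite /T -!mulrA; congr (_ * _).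
  by rewrite [in RHS](mulrCA (b v)) [RHS]mulrCA.
case: (leqP (size (u ++ v)) m) => uv.
  rewrite (sum_word (fun x => (x ++ z == w :> seq letter)%:R * T u v z)) //=.
  by rewrite insubdK.
rewrite (sum_word_gt (fun x => (x ++ z == w :> seq letter)%:R * T u v z)) //.
case: eqP => [e|]; rewrite ?mul0r //.
have := size_bseq w; rewrite -e size_cat leqNgt.
by rewrite (leq_trans uv) // leq_addr.
Qed.

Lemma tmul1t : left_id (@tone R V m) (@tmul R V m).
Proof.
move=> a; apply/ffunP => w; rewrite tmulE (bigD1 [bseq]) //= [X in _ + X]big1.
  rewrite addr0 ffunE /=; under eq_bigr => v _ do rewrite mul1r eq_sym.
  by rewrite sum_word ?size_bseq // valKd.
move=> u un; apply: big1 => v _; rewrite ffunE size_eq0.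
case: (eqVneq (val u) [::]) => [e|_]; last by rewrite mul0r mulr0.
by case/eqP: un; apply: val_inj.
Qed.

Lemma tmult1 : right_id (@tone R V m) (@tmul R V m).
Proof.
move=> a; apply/ffunP => w; rewrite tmulE exchange_big (bigD1 [bseq]) //=.
rewrite [X in _ + X]big1.
  rewrite addr0 ffunE /=; under eq_bigr => v _ do rewrite cats0 mulr1 eq_sym.
  by rewrite sum_word ?size_bseq // valKd.
move=> u un; apply: big1 => v _; rewrite ffunE size_eq0.
case: (eqVneq (val u) [::]) => [e|_]; last by rewrite !mulr0.
by case/eqP: un; apply: val_inj.
Qed.

Lemma tmulDl : left_distributive (@tmul R V m) +%R.
Proof.
move=> a b c; apply/ffunP => w; rewrite [RHS]ffunE !tmulE -big_split /=.
apply: eq_bigr => u _; rewrite -big_split /=; apply: eq_bigr => v _.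
by rewrite ffunE mulrDl mulrDr.
Qed.

Lemma tmulDr : right_distributive (@tmul R V m) +%R.
Proof.
move=> a b c; apply/ffunP => w; rewrite [RHS]ffunE !tmulE -big_split /=.
apply: eq_bigr => u _; rewrite -big_split /=; apply: eq_bigr => v _.
by rewrite ffunE mulrDr mulrDr.
Qed.

Lemma tensor_scaleE (k : R) a w : (k *: a) w = k * a w.
Proof. exact: ffunE. Qed.

Lemma tscalerAl (k : R) a b : k *: tmul a b = tmul (k *: a) b.
Proof.
apply/ffunP => w; rewrite tensor_scaleE !tmulE mulr_sumr; apply: eq_bigr => u _.
rewrite mulr_sumr; apply: eq_bigr => v _.
by rewrite tensor_scaleE mulrCA !mulrA.
Qed.

Lemma tscalerAr (k : R) a b : k *: tmul a b = tmul a (k *: b).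
Proof.
apply/ffunP => w; rewrite tensor_scaleE !tmulE mulr_sumr; apply: eq_bigr => u _.
rewrite mulr_sumr; apply: eq_bigr => v _.
by rewrite tensor_scaleE mulrCA; congr (_ * _); rewrite mulrCA.
Qed.

Lemma tone_neq0 : @tone R V m != 0.
Proof.
by apply/eqP => /ffunP/(_ [bseq]); rewrite !ffunE => /eqP; rewrite oner_eq0.
Qed.

End TensorRing.

(* The type [tensor] already carries the ring structure of pointwise
   multiplication; the alias [talg] carries the one of [tmul]. *)
Definition talg {R : realType} (V : finNormedModType R) (m : nat) : Type :=
  tensor V m.

HB.instance Definition _ (R : realType) (V : finNormedModType R) m :=
  GRing.Lmodule.copy (talg V m) (tensor V m).
HB.instance Definition _ (R : realType) (V : finNormedModType R) m :=
  GRing.Zmodule_isNzRing.Build (talg V m) (@tmulA R V m) (@tmul1t R V m)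
    (@tmult1 R V m) (@tmulDl R V m) (@tmulDr R V m) (@tone_neq0 R V m).
HB.instance Definition _ (R : realType) (V : finNormedModType R) m :=
  GRing.Lmodule_isLalgebra.Build R (talg V m) (@tscalerAl R V m).
HB.instance Definition _ (R : realType) (V : finNormedModType R) m :=
  GRing.Lalgebra_isAlgebra.Build R (talg V m) (@tscalerAr R V m).

(** * Degree filtration, degree derivation and dilations *)

Section Grading.
Context {R : realType} (V : finNormedModType R) (m : nat).
Local Notation T := (talg V m).
Local Notation word := (word V m).
Implicit Types (a b c g : T) (w : word).

Lemma tmul_coef a b w :
  (a * b) w = \sum_(u : word) \sum_(v : word)
                (u ++ v == w :> seq _)%:R * (a u * b v).
Proof. exact: tmulE. Qed.

Lemma tone_coef w : (1 : T) w = (size w == 0%N)%:R.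
Proof. exact: ffunE. Qed.

Lemma tadd_coef a b w : (a + b) w = a w + b w.
Proof. exact: ffunE. Qed.

Lemma topp_coef a w : (- a) w = - a w.
Proof. exact: ffunE. Qed.

Lemma tzero_coef w : (0 : T) w = 0.
Proof. exact: ffunE. Qed.

Lemma tscale_coef (k : R) a w : (k *: a) w = k * a w.
Proof. exact: ffunE. Qed.

Lemma tsum_coef I (r : seq I) (P : pred I) (F : I -> T) w :
  (\sum_(i <- r | P i) F i) w = \sum_(i <- r | P i) F i w.
Proof.
elim/big_rec2: _ => [|i x y _ <-]; [exact: tzero_coef|exact: tadd_coef].
Qed.

Definition tcoefE := (tone_coef, tadd_coef, topp_coef, tzero_coef, tscale_coef).

Lemma talgP a b : (forall w, a w = b w) -> a = b.
Proof. by move=> ab; apply/ffunP => w; exact: ab. Qed.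

(** A multiplicative decreasing filtration that is zero from [m.+1] on: identities modulo higher
    order become equalities after finitely many steps. *)
Definition vanishes_below (n : nat) a : Prop :=
  forall w, (size w < n)%N -> a w = 0.

Lemma vanishes_below0 a : vanishes_below 0 a.
Proof. by []. Qed.

Lemma vanishes_belowW n k a :
  (k <= n)%N -> vanishes_below n a -> vanishes_below k a.
Proof. by move=> kn an w wk; apply: an; exact: leq_trans kn. Qed.

Lemma vanishes_below_eq0 n a : (m < n)%N -> vanishes_below n a -> a = 0.
Proof.
move=> mn an; apply: talgP => w; rewrite tzero_coef; apply: an.
by rewrite (leq_ltn_trans _ mn) // size_bseq.
Qed.

Lemma vanishes_below_zero n : vanishes_below n 0.
Proof. by move=> w _; rewrite tzero_coef. Qed.

Lemma vanishes_belowD n a b :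
  vanishes_below n a -> vanishes_below n b -> vanishes_below n (a + b).
Proof. by move=> an bn w wn; rewrite tadd_coef an // bn // addr0. Qed.

Lemma vanishes_belowN n a : vanishes_below n a -> vanishes_below n (- a).
Proof. by move=> an w wn; rewrite topp_coef an // oppr0. Qed.

Lemma vanishes_belowB n a b :
  vanishes_below n a -> vanishes_below n b -> vanishes_below n (a - b).
Proof. by move=> an /vanishes_belowN; exact: vanishes_belowD. Qed.

Lemma vanishes_belowZ n (k : R) a :
  vanishes_below n a -> vanishes_below n (k *: a).
Proof. by move=> an w wn; rewrite tscale_coef an // mulr0. Qed.

Lemma vanishes_below_sum n I (r : seq I) (P : pred I) (F : I -> T) :
  (forall i, P i -> vanishes_below n (F i)) ->
  vanishes_below n (\sum_(i <- r | P i) F i).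
Proof.
move=> Fn; elim/big_ind: _ => //; first exact: vanishes_below_zero.
exact: vanishes_belowD.
Qed.

Lemma vanishes_belowM n k a b :
  vanishes_below n a -> vanishes_below k b -> vanishes_below (n + k) (a * b).
Proof.
move=> an bk w wnk; rewrite tmul_coef big1 // => u _; rewrite big1 // => v _.
case: eqP => [e|]; last by rewrite mul0r.
case: (ltnP (size u) n) => un; first by rewrite an // mul0r mulr0.
case: (ltnP (size v) k) => vk; first by rewrite bk // !mulr0.
by move: wnk; rewrite -e size_cat ltnNge leq_add.
Qed.

Lemma vanishes_belowX n a k :
  vanishes_below n a -> vanishes_below (k * n) (a ^+ k).
Proof.
move=> an; elim: k => [|k IH]; first exact: vanishes_below0.
by rewrite exprS mulSn; exact: vanishes_belowM.
Qed.

Lemma nilpotent_expr a k : vanishes_below 1 a -> (m < k)%N -> a ^+ k = 0.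
Proof.
move=> a1 mk; apply: (@vanishes_below_eq0 k) => //.
by have := vanishes_belowX (k := k) a1; rewrite muln1.
Qed.

Lemma vanishes_below1P a : vanishes_below 1 a <-> a [bseq] = 0.
Proof.
split=> [->//|a0 w]; rewrite ltnS leqn0 size_eq0 => /eqP w0.
by rewrite -a0; congr (fun_of_fin a _); apply: val_inj.
Qed.

Lemma tmul_coef0 a b : (a * b) [bseq] = a [bseq] * b [bseq].
Proof.
rewrite tmul_coef (bigD1 [bseq]) //= [X in _ + X]big1.
  rewrite addr0 (bigD1 [bseq]) //= big1 ?addr0 ?mul1r // => v vn.
  case: eqP => [e|]; rewrite ?mul0r //.
  by case/eqP: vn; apply: val_inj.
move=> u un; apply: big1 => v _; case: eqP => [e|]; rewrite ?mul0r //.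
case/eqP: un; apply: val_inj; move/(congr1 size)/eqP: e.
by rewrite size_cat addn_eq0 => /andP[/nilP].
Qed.

(** The derivation [D] of the overview; its eigenspaces are the homogeneous components. *)
Definition tdeg a : T := [ffun w : word => (size w)%:R * a w].

Lemma tdeg_coef a w : tdeg a w = (size w)%:R * a w.
Proof. exact: ffunE. Qed.

Lemma tdegD a b : tdeg (a + b) = tdeg a + tdeg b.
Proof. by apply: talgP => w; rewrite !(tdeg_coef, tcoefE) mulrDr. Qed.

Lemma tdegB a b : tdeg (a - b) = tdeg a - tdeg b.
Proof. by apply: talgP => w; rewrite !(tdeg_coef, tcoefE) mulrBr. Qed.

Lemma tdegZ (k : R) a : tdeg (k *: a) = k *: tdeg a.
Proof. by apply: talgP => w; rewrite !(tdeg_coef, tcoefE) mulrCA. Qed.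

Lemma tdeg_sum I (r : seq I) (P : pred I) (F : I -> T) :
  tdeg (\sum_(i <- r | P i) F i) = \sum_(i <- r | P i) tdeg (F i).
Proof.
apply: talgP => w; rewrite tdeg_coef !tsum_coef mulr_sumr.
by apply: eq_bigr => i _; rewrite tdeg_coef.
Qed.

Lemma tdegM a b : tdeg (a * b) = tdeg a * b + a * tdeg b.
Proof.
apply: talgP => w; rewrite tdeg_coef tadd_coef !tmul_coef mulr_sumr -big_split.
apply: eq_bigr => u _; rewrite mulr_sumr -big_split; apply: eq_bigr => v _ /=.
rewrite !tdeg_coef; case: eqP => [<-|]; last by rewrite !(mul0r, mulr0, addr0).
by rewrite size_cat natrD !mul1r mulrDl -mulrA; congr (_ + _); rewrite mulrCA.
Qed.

Lemma tdeg1 : tdeg 1 = 0.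
Proof.
apply: talgP => w; rewrite tdeg_coef tone_coef tzero_coef.
by case: eqP => [->|_]; rewrite ?mulr0n ?mul0r ?mulr0.
Qed.

Lemma vanishes_below_tdeg n a : vanishes_below n a -> vanishes_below n (tdeg a).
Proof. by move=> an w wn; rewrite tdeg_coef an // mulr0. Qed.

Definition tproj (n : nat) a : T := [ffun w : word => (size w == n)%:R * a w].

Lemma tproj_coef n a w : tproj n a w = (size w == n)%:R * a w.
Proof. exact: ffunE. Qed.

Lemma tproj_tdeg n a : tproj n (tdeg a) = n%:R *: tproj n a.
Proof.
apply: talgP => w; rewrite tproj_coef tscale_coef tdeg_coef tproj_coef.
by case: eqP => [->|]; rewrite ?mul1r // !mul0r mulr0.
Qed.

Lemma tprojD n a b : tproj n (a + b) = tproj n a + tproj n b.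
Proof. by apply: talgP => w; rewrite !(tproj_coef, tcoefE) mulrDr. Qed.

Lemma tprojZ n (k : R) a : tproj n (k *: a) = k *: tproj n a.
Proof. by apply: talgP => w; rewrite !(tproj_coef, tcoefE) mulrCA. Qed.

Lemma tproj_sum n I (r : seq I) (P : pred I) (F : I -> T) :
  tproj n (\sum_(i <- r | P i) F i) = \sum_(i <- r | P i) tproj n (F i).
Proof.
apply: talgP => w; rewrite tproj_coef !tsum_coef mulr_sumr.
by apply: eq_bigr => i _; rewrite tproj_coef.
Qed.

Lemma tproj_vanishes n k a : (k < n)%N -> vanishes_below n a -> tproj k a = 0.
Proof.
move=> kn an; apply: talgP => w; rewrite tproj_coef tzero_coef.
by case: eqP => [wk|]; rewrite ?mul0r // an ?mulr0 // wk.
Qed.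

Lemma vanishes_below_tproj n a : vanishes_below n (tproj n a).
Proof.
by move=> w wn; rewrite tproj_coef; case: eqP wn => [->|]; rewrite ?ltnn ?mul0r.
Qed.

Lemma vanishes_belowS_tproj n a :
  vanishes_below n a -> vanishes_below n.+1 (a - tproj n a).
Proof.
move=> an w; rewrite ltnS leq_eqVlt tadd_coef topp_coef tproj_coef.
case/orP => [->|wn]; first by rewrite mul1r subrr.
by rewrite an // mulr0 subr0.
Qed.

Lemma tproj_homogeneous n k a : tdeg a = k%:R *: a ->
  tproj n a = (k == n)%:R *: a.
Proof.
move=> ak; apply: talgP => w; rewrite tproj_coef tscale_coef.
have : (size w)%:R * a w = k%:R * a w by rewrite -tdeg_coef ak tscale_coef.
case: (eqVneq (size w) k) => [->//|wk] /eqP.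
(* On a word of length other than k the two eigenvalues differ, so the coordinate is zero. *)
rewrite -subr_eq0 -mulrBl mulf_eq0 subr_eq0 eqr_nat (negPf wk) /= => /eqP ->.
by rewrite !mulr0.
Qed.

Definition tdil (t : R) a : T := dilation t a.

Lemma tdil_coef t a w : tdil t a w = t ^+ size w * a w.
Proof. exact: ffunE. Qed.

Lemma tdilM t a b : tdil t (a * b) = tdil t a * tdil t b.
Proof.
apply: talgP => w; rewrite tdil_coef !tmul_coef mulr_sumr; apply: eq_bigr => u _.
rewrite mulr_sumr; apply: eq_bigr => v _; rewrite !tdil_coef.
case: eqP => [<-|]; last by rewrite !mul0r mulr0.
by rewrite size_cat exprD !mul1r mulrACA.
Qed.

Lemma tdil1 t : tdil t 1 = 1.
Proof.
apply: talgP => w; rewrite tdil_coef tone_coef.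
by case: eqP => [->|]; rewrite ?mul1r // mulr0.
Qed.

Lemma tdilX t a k : tdil t (a ^+ k) = tdil t a ^+ k.
Proof. by elim: k => [|k IH]; rewrite ?tdil1 // !exprS tdilM IH. Qed.

Lemma tdilZ t (k : R) a : tdil t (k *: a) = k *: tdil t a.
Proof. by apply: talgP => w; rewrite !(tdil_coef, tcoefE) mulrCA. Qed.

Lemma tdil_sum t I (r : seq I) (P : pred I) (F : I -> T) :
  tdil t (\sum_(i <- r | P i) F i) = \sum_(i <- r | P i) tdil t (F i).
Proof.
apply: talgP => w; rewrite tdil_coef !tsum_coef mulr_sumr.
by apply: eq_bigr => i _; rewrite tdil_coef.
Qed.

Lemma tdil_homogeneous t n a : tdeg a = n%:R *: a -> tdil t a = t ^+ n *: a.
Proof.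
move=> an; rewrite -[in LHS](scale1r a).
have <- : tproj n a = 1 *: a by rewrite (tproj_homogeneous n an) eqxx.
apply: talgP => w; rewrite tdil_coef tscale_coef tproj_coef.
have := congr1 (fun x : T => x w) (tproj_homogeneous n an).
rewrite tproj_coef tscale_coef eqxx mul1r => <-.
by case: eqP => [->|]; rewrite ?mul1r // !mul0r !mulr0.
Qed.

End Grading.

(** * The free nilpotent Lie algebra and Dynkin's theorem *)

Section LieAlgebra.
Context {R : realType} (V : finNormedModType R) (m : nat).
Local Notation T := (talg V m).
Local Notation word := (word V m).
Local Notation letter := 'I_(\dim {:V}).
Local Notation L := (@free_nilpotent_lie R V m : T -> Prop).
Implicit Types (a b c x y z : T) (w : word) (s : seq letter).

Definition tbr a b : T := a * b - b * a.

Lemma lie_vec v : L (tvec m v).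
Proof. by move=> K [_]; apply; exists v. Qed.

Lemma lie0 : L 0.
Proof. by move=> K [[]]. Qed.

Lemma lieZD (k : R) a b : L a -> L b -> L (k *: a + b).
Proof.
by move=> La Lb K KK; have [[_ KZD _] _] := KK; apply: KZD; [apply: La|apply: Lb].
Qed.

Lemma lie_br a b : L a -> L b -> L (tbr a b).
Proof.
by move=> La Lb K KK; have [[_ _ Kbr] _] := KK; apply: Kbr; [apply: La|apply: Lb].
Qed.

Lemma lieZ (k : R) a : L a -> L (k *: a).
Proof. by move=> La; rewrite -[_ *: _]addr0; apply: lieZD => //; exact: lie0. Qed.

Lemma lieD a b : L a -> L b -> L (a + b).
Proof. by move=> La Lb; rewrite -[a]scale1r; exact: lieZD. Qed.

Lemma lieN a : L a -> L (- a).
Proof. by rewrite -scaleN1r; exact: lieZ. Qed.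

Lemma lie_sum I (r : seq I) (P : pred I) (F : I -> T) :
  (forall i, P i -> L (F i)) -> L (\sum_(i <- r | P i) F i).
Proof. by move=> LF; elim/big_ind: _ => //; [exact: lie0|exact: lieD]. Qed.

(** Minimality of the generated Lie subalgebra, as an induction principle. *)
Lemma lie_ind (K : T -> Prop) :
  K 0 -> (forall (k : R) a b, K a -> K b -> K (k *: a + b)) ->
  (forall a b, K a -> K b -> K (tbr a b)) -> (forall v, K (tvec m v)) ->
  forall a, L a -> K a.
Proof.
move=> K0 KZD Kbr Kv a; apply; split; first by split.
by move=> _ [v _ <-]; exact: Kv.
Qed.

Definition tletter (i : letter) : T := [ffun w : word => (val w == [:: i])%:R].

Lemma tletter_coef i w : tletter i w = (val w == [:: i])%:R.
Proof. exact: ffunE. Qed.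

Lemma tletterE i : tletter i = tvec m (vbasis {:V})`_i.
Proof.
apply: talgP => w; rewrite tletter_coef ffunE.
case: (val w) => [//|j [|k s]]; last by rewrite eqseq_cons andbF.
rewrite /vcoord coord_free ?(basis_free (vbasisP _)) //.
by rewrite eqseq_cons andbT eq_sym.
Qed.

Lemma tvecE (v : V) : tvec m v = \sum_i vcoord i v *: tletter i :> T.
Proof.
apply: talgP => w; rewrite ffunE tsum_coef.
under eq_bigr => i _ do rewrite tscale_coef tletter_coef.
case: (val w) => [|j [|k s]].
- by rewrite big1 // => i _; rewrite mulr0.
- rewrite (bigD1 j) //= eqxx mulr1 big1 ?addr0 // => i ij.
  by rewrite eqseq_cons andbT eq_sym (negPf ij) mulr0.
by rewrite big1 // => i _; rewrite eqseq_cons andbF mulr0.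
Qed.

Lemma lie_letter i : L (tletter i).
Proof. by rewrite tletterE; exact: lie_vec. Qed.

Lemma tdeg_letter i : tdeg (tletter i) = tletter i.
Proof.
apply: talgP => w; rewrite tdeg_coef tletter_coef.
by case: eqP => [->|]; rewrite ?mul1r // mulr0.
Qed.

Lemma tletter_vanishes i : vanishes_below 1 (tletter i).
Proof. by apply/vanishes_below1P; rewrite tletter_coef. Qed.

(** Right-normed bracketing. The one-letter word is a case of its own, since bracketing with the
    value 0 of the empty word would give 0. *)
Fixpoint rbracket s : T :=
  match s with
  | [::] => 0
  | [:: i] => tletter i
  | i :: s' => tbr (tletter i) (rbracket s')
  end.

Arguments rbracket : simpl never.

Lemma rbracket_cons i s : s != [::] ->
  rbracket (i :: s) = tbr (tletter i) (rbracket s).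
Proof. by case: s. Qed.

Lemma lie_rbracket s : L (rbracket s).
Proof.
elim: s => [|i [|j s] IH]; [exact: lie0|exact: lie_letter|].
by rewrite rbracket_cons //; apply: lie_br => //; exact: lie_letter.
Qed.

Lemma tdeg_tbr a b : tdeg (tbr a b) = tbr (tdeg a) b + tbr a (tdeg b).
Proof.
by rewrite /tbr tdegB !tdegM; apply: talgP => w; rewrite !tcoefE; ring.
Qed.

Lemma tdeg_rbracket s : tdeg (rbracket s) = (size s)%:R *: rbracket s.
Proof.
elim: s => [|i [|j s] IH].
- by rewrite scale0r; apply: talgP => w; rewrite tdeg_coef tzero_coef mulr0.
- by rewrite scale1r; exact: tdeg_letter.
rewrite rbracket_cons // tdeg_tbr IH tdeg_letter /= -[(size s).+2]addn1 natrD.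
by rewrite scalerDl scale1r addrC /tbr -scalerAr -scalerAl -scalerBr.
Qed.

(** The bracket is an eigenvector of [tdeg] for [size s], and no word has that length. *)
Lemma rbracket_gt s : (m < size s)%N -> rbracket s = 0.
Proof.
move=> ms; apply: talgP => w; rewrite tzero_coef.
have := congr1 (fun x : T => x w) (tdeg_rbracket s).
rewrite /= tdeg_coef tscale_coef => /eqP.
rewrite -subr_eq0 -mulrBl mulf_eq0 subr_eq0 eqr_nat => /orP[/eqP e|/eqP //].
by move: ms; rewrite -e ltnNge size_bseq.
Qed.

(** The Dynkin operator, which multiplies homogeneous Lie elements by their degree. *)
Definition dynkin a : T := \sum_(w : word) a w *: rbracket w.

Lemma lie_dynkin a : L (dynkin a).
Proof. by apply: lie_sum => w _; apply: lieZ; exact: lie_rbracket. Qed.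

Lemma dynkin_is_linear (k : R) a b : dynkin (k *: a + b) = k *: dynkin a + dynkin b.
Proof.
rewrite /dynkin scaler_sumr -big_split; apply: eq_bigr => w _ /=.
by rewrite tadd_coef tscale_coef scalerDl scalerA.
Qed.

Lemma dynkin0 : dynkin 0 = 0.
Proof. by rewrite /dynkin big1 // => w _; rewrite tzero_coef scale0r. Qed.

Lemma dynkinD a b : dynkin (a + b) = dynkin a + dynkin b.
Proof. by have := dynkin_is_linear 1 a b; rewrite !scale1r. Qed.

Lemma dynkinZ (k : R) a : dynkin (k *: a) = k *: dynkin a.
Proof. by have := dynkin_is_linear k a 0; rewrite dynkin0 !addr0. Qed.

Lemma dynkinB a b : dynkin (a - b) = dynkin a - dynkin b.
Proof. by rewrite -scaleN1r dynkinD dynkinZ scaleN1r. Qed.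

Lemma dynkin_letter i : (0 < m)%N -> dynkin (tletter i) = tletter i.
Proof.
move=> m0; rewrite /dynkin.
under eq_bigr => w _ do rewrite tletter_coef.
have si : (size [:: i] <= m)%N by [].
rewrite (bigD1 (insubd [bseq] [:: i] : word)) //= insubdK // eqxx scale1r.
rewrite big1 ?addr0 // => w wn; case: eqP => [e|]; rewrite ?scale0r //.
by rewrite -e valKd eqxx in wn.
Qed.

Lemma tbr_sumr I (r : seq I) (P : pred I) a (F : I -> T) :
  tbr a (\sum_(i <- r | P i) F i) = \sum_(i <- r | P i) tbr a (F i).
Proof. by rewrite /tbr mulr_sumr mulr_suml -sumrB. Qed.

Lemma tbrZr (k : R) a b : tbr a (k *: b) = k *: tbr a b.
Proof. by rewrite /tbr -scalerAr -scalerAl -scalerBr. Qed.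

Lemma tletterM_coef i b w :
  (tletter i * b) w = \sum_(v : word) (i :: v == w :> seq _)%:R * b v.
Proof.
rewrite tmul_coef exchange_big; apply: eq_bigr => v _ /=.
under eq_bigr => u _ do rewrite tletter_coef mulrCA mulrA.
(* For m = 0 no word has one letter, and both sides vanish. *)
case: (posnP m) => m0.
  rewrite big1 => [|u _].
    case: eqP => [e|]; last by rewrite mul0r.
    by have := size_bseq w; rewrite -e => /leq_trans/(_ (eq_leq m0)).
  case: eqP => [e|]; last by rewrite !mul0r.
  have := size_bseq u; rewrite -[size _]/(size (val u)) e.
  by move=> /leq_trans/(_ (eq_leq m0)).
have si : (size [:: i] <= m)%N by [].
rewrite (bigD1 (insubd [bseq] [:: i] : word)) //= -[bseqval _]/(val _) insubdK //.
rewrite eqxx mul1r big1 ?addr0 // => u un; case: eqP => [e|]; rewrite ?mul0r //.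
by rewrite -e valKd eqxx in un.
Qed.

(** Prefixing a letter to a nonempty word brackets with it; the hypothesis removes the empty word,
    where this fails. *)
Lemma dynkin_letterM i b : vanishes_below 1 b ->
  dynkin (tletter i * b) = tbr (tletter i) (dynkin b).
Proof.
move=> b1; rewrite {2}/dynkin tbr_sumr.
transitivity (\sum_(v : word) b v *: rbracket (i :: v)); last first.
  apply: eq_bigr => v _; rewrite tbrZr.
  case: (eqVneq (val v) [::]) => [v0|vn]; last by rewrite rbracket_cons.
  by rewrite b1 ?scale0r // -[size _]/(size (val v)) v0.
rewrite /dynkin.
under eq_bigr => w _ do rewrite tletterM_coef scaler_suml.
rewrite exchange_big; apply: eq_bigr => v _ /=.
case: (leqP (size (i :: v)) m) => iv.
  rewrite (bigD1 (insubd [bseq] (i :: v) : word)) //= -[bseqval (insubd _ _)]/(val _).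
  rewrite insubdK // eqxx mul1r big1 ?addr0 // => w wn.
  case: eqP => [e|]; rewrite ?mul0r ?scale0r //.
  by rewrite e valKd eqxx in wn.
rewrite (@rbracket_gt (i :: v)) // scaler0 big1 // => w _.
case: eqP => [e|]; rewrite ?mul0r ?scale0r //.
by move: iv; rewrite e ltnNge size_bseq.
Qed.

Lemma tbrDl a b c : tbr (a + b) c = tbr a c + tbr b c.
Proof. by rewrite /tbr mulrDl mulrDr opprD addrACA. Qed.

Lemma tbrZl (k : R) a b : tbr (k *: a) b = k *: tbr a b.
Proof. by rewrite /tbr -scalerAr -scalerAl -scalerBr. Qed.

(** The adjoint action respects brackets: this makes the product identity for [dynkin] stable under
    brackets in its left factor. *)
Lemma jacobi a b c : tbr (tbr a b) c = tbr a (tbr b c) - tbr b (tbr a c).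
Proof.
rewrite /tbr !(mulrBl, mulrBr) !mulrA.
by apply: talgP => w; rewrite !tcoefE; ring.
Qed.

(* Dynkin's theorem, proved jointly with the identity on products on which it
   rests. *)
Lemma lie_dynkinP x : L x ->
  [/\ vanishes_below 1 x,
      forall b, vanishes_below 1 b -> dynkin (x * b) = tbr x (dynkin b)
    & dynkin x = tdeg x].
Proof.
move: x; apply: lie_ind.
- split; first exact: vanishes_below_zero.
    by move=> b _; rewrite mul0r dynkin0 /tbr mul0r mulr0 subrr.
  by rewrite dynkin0; apply: talgP => w; rewrite tdeg_coef tzero_coef mulr0.
- move=> k a b [a1 aM aD] [b1 bM bD]; split.
  + by apply: vanishes_belowD => //; exact: vanishes_belowZ.
  + move=> c c1; rewrite mulrDl -scalerAl dynkin_is_linear aM // bM //.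
    by rewrite tbrDl tbrZl.
  + by rewrite dynkin_is_linear aD bD tdegD tdegZ.
- move=> a b [a1 aM aD] [b1 bM bD]; split.
  + by apply: vanishes_belowB; apply: (@vanishes_belowW _ _ _ (1 + 1)%N) => //;
      exact: vanishes_belowM.
  + move=> c c1; rewrite mulrBl dynkinB -!mulrA !aM ?bM ?aM ?jacobi //;
      by apply: (@vanishes_belowW _ _ _ (1 + 1)%N) => //; exact: vanishes_belowM.
  (* The product identity gives [a, D b] - [b, D a], which is D [a, b] by the derivation rule. *)
  + rewrite dynkinB aM // bM // aD bD /tbr tdegB !tdegM.
    by apply: talgP => w; rewrite !tcoefE; ring.
move=> v; rewrite tvecE.
elim/big_ind: _ => [|a b [a1 aM aD] [b1 bM bD]|i _].
- split; first exact: vanishes_below_zero.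
    by move=> b _; rewrite mul0r dynkin0 /tbr mul0r mulr0 subrr.
  by rewrite dynkin0; apply: talgP => w; rewrite tdeg_coef tzero_coef mulr0.
- split; first exact: vanishes_belowD.
    by move=> c c1; rewrite mulrDl dynkinD aM // bM // tbrDl.
  by rewrite dynkinD aD bD tdegD.
split.
- by apply: vanishes_belowZ; exact: tletter_vanishes.
- by move=> b b1; rewrite -scalerAl dynkinZ dynkin_letterM // tbrZl.
rewrite dynkinZ tdegZ tdeg_letter; case: (posnP m) => m0.
  rewrite (_ : tletter i = 0); last first.
    apply: (@vanishes_below_eq0 _ _ _ 1); first by rewrite m0.
    exact: tletter_vanishes.
  by rewrite dynkin0.
by rewrite dynkin_letter.
Qed.

Lemma lie_vanishes x : L x -> vanishes_below 1 x.
Proof. by case/lie_dynkinP. Qed.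

Lemma tdeg_lie x : L x -> tdeg x = dynkin x.
Proof. by case/lie_dynkinP. Qed.

Lemma lie_tdeg x : L x -> L (tdeg x).
Proof. by move/tdeg_lie->; exact: lie_dynkin. Qed.

Lemma tproj_dynkin n x :
  tproj n (dynkin x) = \sum_(w : word | size w == n) x w *: rbracket w.
Proof.
rewrite /dynkin tproj_sum [RHS]big_mkcond; apply: eq_bigr => w _.
rewrite tprojZ (tproj_homogeneous n (tdeg_rbracket w)).
by case: eqP => _; rewrite ?scale1r ?scale0r ?scaler0.
Qed.

(** Dynkin's theorem in degree n, divided by n. It shows that the Lie algebra is graded, and it
    bounds the bracket coefficients by coordinates, as the norm estimate requires. *)
Lemma tproj_lieE n x : L x -> (0 < n)%N ->
  tproj n x = \sum_(w : word | size w == n) (n%:R^-1 * x w) *: rbracket w.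
Proof.
move=> Lx n0; under eq_bigr => w _ do rewrite -scalerA.
rewrite -scaler_sumr -tproj_dynkin -tdeg_lie // tproj_tdeg scalerA mulVf ?scale1r //.
by rewrite pnatr_eq0 -lt0n.
Qed.

Lemma lie_tproj n x : L x -> L (tproj n x).
Proof.
move=> Lx; case: (posnP n) => [->|n0].
  by rewrite (tproj_vanishes (n := 1)) //; [exact: lie0|exact: lie_vanishes].
by rewrite tproj_lieE //; apply: lie_sum => w _; apply: lieZ; exact: lie_rbracket.
Qed.

End LieAlgebra.

(** * Exponentials and the free nilpotent group *)

Section NilpotentGroup.
Context {R : realType} (V : finNormedModType R) (m : nat).
Local Notation T := (talg V m).
Local Notation word := (word V m).
Local Notation L := (@free_nilpotent_lie R V m : T -> Prop).
Local Notation G := (@free_nilpotent_group R V m : T -> Prop).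
Implicit Types (a b c x y z g h u : T).

Definition expT a : T := texp a.
Definition invT a : T := tinv a.
Definition expterm a (k : nat) : T := k`!%:R^-1 *: a ^+ k.

Lemma texpnE a k : texpn a k = a ^+ k :> T.
Proof. by elim: k => [//|k IH]; rewrite exprS -IH. Qed.

Lemma expTE a : expT a = \sum_(k < m.+1) expterm a k.
Proof. by apply: eq_bigr => k _; rewrite /expterm -texpnE. Qed.

(** The equation f' = a f for f(s) = exp(s a), read on Taylor coefficients in s. Differential
    equations in s are handled on coefficients, purely algebraically. *)
Lemma exptermS a k : k.+1%:R *: expterm a k.+1 = a * expterm a k.
Proof.
rewrite /expterm factS natrM invfM scalerA mulrA mulfV ?pnatr_eq0 // mul1r.
by rewrite exprS scalerAr.
Qed.

Lemma expterm0 a : expterm a 0 = 1.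
Proof. by rewrite /expterm fact0 invr1 scale1r expr0. Qed.

Lemma expterm_comm a k : a * expterm a k = expterm a k * a.
Proof. by rewrite /expterm -scalerAr -scalerAl -exprS exprSr. Qed.

Lemma expterm_vanishes a k : vanishes_below 1 a -> vanishes_below k (expterm a k).
Proof.
move=> a1; apply: vanishes_belowZ; have := vanishes_belowX (k := k) a1.
by rewrite muln1.
Qed.

(** Cauchy product of two power series in s; [convS] is its Leibniz rule. *)
Definition conv (f f' : nat -> T) (n : nat) : T :=
  \sum_(i < n.+1) f i * f' (n - i)%N.

Lemma convS (f df f' df' : nat -> T) n :
  (forall k, k.+1%:R *: f k.+1 = df k) ->
  (forall k, k.+1%:R *: f' k.+1 = df' k) ->
  n.+1%:R *: conv f f' n.+1 = conv df f' n + conv f df' n.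
Proof.
move=> fS f'S.
transitivity (\sum_(i < n.+2) i%:R *: (f i * f' (n.+1 - i)%N)
   + \sum_(i < n.+2) (n.+1 - i)%:R *: (f i * f' (n.+1 - i)%N)).
  rewrite -big_split /conv scaler_sumr; apply: eq_bigr => i _ /=.
  by rewrite -scalerDl -natrD subnKC // -ltnS.
congr (_ + _).
  rewrite big_ord_recl scale0r add0r; apply: eq_bigr => i _.
  by rewrite lift0 subSS scalerAl fS.
rewrite big_ord_recr -[LHS]/(_ + _) [X in _ + X](_ : _ = 0); last first.
  by rewrite (_ : (n.+1 - ord_max)%N = 0%N) ?scale0r //; exact: subnn.
rewrite addr0; apply: eq_bigr => i _.
have in1 : (i <= n)%N by rewrite -ltnS.
by rewrite -f'S -scalerAr -(subSn in1).
Qed.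

(** Evaluation at s = 1 is multiplicative: the extra terms of the product have order greater than m
    and vanish. *)
Lemma conv_sum (f f' : nat -> T) :
  (forall k, vanishes_below k (f k)) -> (forall k, vanishes_below k (f' k)) ->
  \sum_(n < m.+1) conv f f' n = (\sum_(i < m.+1) f i) * (\sum_(j < m.+1) f' j).
Proof.
move=> fv f'v; rewrite mulr_suml.
under [RHS]eq_bigr => i _ do rewrite mulr_sumr.
transitivity (\sum_(n < m.+1) \sum_(i < m.+1) \sum_(j < m.+1)
   (if (i + j)%N == n then f i * f' j else 0)).
  apply: eq_bigr => n _; rewrite /conv.
  rewrite (big_ord_widen_cond m.+1 xpredT (fun i => f i * f' (n - i)%N)) //.
  rewrite big_mkcond; apply: eq_bigr => i _ /=.
  case: ifP => inn; last first.
    rewrite big1 // => j _; case: eqP => // e.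
    by move: inn; rewrite -e ltnS leq_addr.
  have jm : (n - i < m.+1)%N by rewrite ltnS (leq_trans (leq_subr _ _)) // -ltnS.
  rewrite (bigD1 (Ordinal jm)) //= subnKC // eqxx big1 ?addr0 // => j.
  move=> /eqP jn; case: eqP => // e; case: jn; apply: val_inj => /=.
  by rewrite -e addKn.
rewrite exchange_big; apply: eq_bigr => i _ /=.
rewrite exchange_big; apply: eq_bigr => j _ /=.
case: (ltnP (i + j) m.+1) => ij.
  rewrite (bigD1 (Ordinal ij)) //= eqxx big1 ?addr0 // => n /eqP nn.
  by case: eqP => // e; case: nn; apply: val_inj.
have -> : f i * f' j = 0.
  by apply: (vanishes_below_eq0 ij); exact: vanishes_belowM.
by rewrite big1 // => n _; case: ifP.
Qed.

(** The series exp(- s a) exp(s a) has derivative zero, so only its constant coefficient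
    survives. *)
Lemma expTN a : vanishes_below 1 a -> expT (- a) * expT a = 1.
Proof.
move=> a1; rewrite !expTE -conv_sum; last 2 first.
- by move=> k; apply: expterm_vanishes; exact: vanishes_belowN.
- by move=> k; exact: expterm_vanishes.
rewrite big_ord_recl big1.
  by rewrite addr0 /conv big_ord1 subnn !expterm0 mul1r.
move=> n _; rewrite lift0; apply/eqP.
have := convS n (exptermS (- a)) (exptermS a).
rewrite [X in _ = X](_ : _ = 0); last first.
  rewrite -big_split big1 // => i _ /=.
  by rewrite expterm_comm mulrA mulrN mulNr addNr.
by move/eqP; rewrite scaler_eq0 pnatr_eq0.
Qed.

(* If [Y] satisfies the recurrence of the Taylor coefficients in [s] of a
   solution of [y' = z y + c exp (s z)], then [w s := y exp (- s z)] satisfies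
   [w' = [z, w] + c] and so stays in the Lie algebra. *)
Lemma expT_intertwine z c (Y : nat -> T) :
  L z -> L c -> L (Y 0) ->
  (forall n, n.+1%:R *: Y n.+1 = z * Y n + c * expterm z n) ->
  exists2 w, L w & \sum_(n < m.+1) Y n = w * expT z.
Proof.
move=> Lz Lc LY YS.
have [w [w0 wS]] : exists w : nat -> T, w 0%N = Y 0%N /\
    forall k, k.+1%:R *: w k.+1 = tbr z (w k) + (if k is 0 then c else 0).
  exists (fix w n := match n with
    | 0 => Y 0%N
    | k.+1 => k.+1%:R^-1 *: (tbr z (w k) + (if k is 0 then c else 0)) end).
  by split=> // k; rewrite scalerA mulfV ?pnatr_eq0 // scale1r.
have wE k : w k.+1 = k.+1%:R^-1 *: (tbr z (w k) + (if k is 0 then c else 0)).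
  by rewrite -wS scalerA mulVf ?pnatr_eq0 // scale1r.
have Lw k : L (w k).
  elim: k => [|k IH]; first by rewrite w0.
  rewrite wE; apply: lieZ; apply: lieD; first exact: lie_br.
  by case: k {IH} => [//|k]; exact: lie0.
have z1 := lie_vanishes Lz.
have wv k : vanishes_below k (w k).
  elim: k => [//|k IH]; rewrite wE; apply: vanishes_belowZ; apply: vanishes_belowD.
    apply: vanishes_belowB; first by rewrite -add1n; exact: vanishes_belowM.
    by rewrite -addn1; exact: vanishes_belowM.
  by case: k {IH} => [|k]; [exact: lie_vanishes|exact: vanishes_below_zero].
exists (\sum_(i < m.+1) w i); first by apply: lie_sum => i _.
rewrite expTE -conv_sum //; last by move=> k; exact: expterm_vanishes.
(* [Y] and the Cauchy product of [w] with exp(s z) satisfy the same recurrence with the same initial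
   term. *)
apply: eq_bigr => n _; elim: (nat_of_ord n) => [|k IH].
  by rewrite /conv big_ord1 expterm0 mulr1 w0.
apply: (@scalerI _ _ k.+1%:R); first by rewrite pnatr_eq0.
rewrite YS (convS k wS (exptermS z)) IH -big_split mulr_sumr.
transitivity (\sum_(i < k.+1) (z * (w i * expterm z (k - i)%N) +
    (if nat_of_ord i is 0 then c else 0) * expterm z (k - i)%N)).
  rewrite big_split; congr (_ + _); rewrite big_ord_recl subn0 big1 ?[RHS]addr0 //.
  by move=> i _; rewrite lift0 mul0r.
apply: eq_bigr => i _; rewrite mulrDl /tbr mulrBl !mulrA.
by apply: talgP => w'; rewrite !tcoefE; ring.
Qed.

(** Y(s) = D exp(s z) solves Y' = z Y + (D z) exp(s z), and D z is in the Lie algebra. *)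
Lemma tdeg_expT z : L z -> exists2 w, L w & tdeg (expT z) = w * expT z.
Proof.
move=> Lz; have [|||w Lw e] :=
  @expT_intertwine z (tdeg z) (fun n => tdeg (expterm z n)) Lz.
- exact: lie_tdeg.
- by rewrite expterm0 tdeg1; exact: lie0.
- by move=> n; rewrite -tdegZ exptermS tdegM addrC.
by exists w => //; rewrite -e -tdeg_sum -expTE.
Qed.

(** The adjoint action of exp(z) preserves the Lie algebra: Y(s) = exp(s z) x solves Y' = z Y. *)
Lemma conj_expT z x : L z -> L x -> exists2 w, L w & expT z * x = w * expT z.
Proof.
move=> Lz Lx; have [|||w Lw e] :=
  @expT_intertwine z 0 (fun n => expterm z n * x) Lz.
- exact: lie0.
- by rewrite expterm0 mul1r.
- by move=> n; rewrite mul0r addr0 scalerAl exptermS mulrA.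
by exists w => //; rewrite -e -mulr_suml -expTE.
Qed.

Lemma expT_coef0 z : L z -> expT z [bseq] = 1.
Proof.
move=> Lz; have z0 := lie_vanishes Lz.
rewrite expTE big_ord_recl expterm0 tadd_coef tsum_coef big1 ?addr0 => [|i _].
  by rewrite tone_coef.
exact: (expterm_vanishes (k := lift ord0 i) z0).
Qed.

(** A finite geometric series in the nilpotent element 1 - g. *)
Lemma invTK g : g [bseq] = 1 -> invT g * g = 1 /\ g * invT g = 1.
Proof.
move=> g0; have -> : invT g = \sum_(k < m.+1) (1 - g) ^+ k.
  by apply: eq_bigr => k _; rewrite texpnE.
have n0 : (1 - g) ^+ m.+1 = 0.
  apply: nilpotent_expr => //; apply/vanishes_below1P.
  by rewrite !tcoefE g0 subrr.
have : - 1 = - (g * \sum_(k < m.+1) (1 - g) ^+ k).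
  have := subrX1 (1 - g) m.+1; rewrite n0 sub0r => ->.
  by rewrite addrC addrA addNr add0r mulNr.
move=> /oppr_inj gK; split => //.
rewrite [RHS]gK mulr_suml mulr_sumr; apply: eq_bigr => k _.
have gc : GRing.comm g (1 - g) by rewrite /GRing.comm mulrBr mulrBl mulr1 mul1r.
by rewrite (commrX k gc).
Qed.

Lemma invT_unique g h : g [bseq] = 1 -> h * g = 1 -> invT g = h.
Proof. by move=> /invTK[_ gK] hg; rewrite -[invT g]mul1r -hg -mulrA gK mulr1. Qed.

Lemma invT_expT z : L z -> invT (expT z) = expT (- z).
Proof.
move=> Lz; apply: invT_unique; first exact: expT_coef0.
by apply: expTN; exact: lie_vanishes.
Qed.

Lemma group_expT z : L z -> G (expT z).
Proof. by move=> Lz; exists z. Qed.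

Lemma groupP g : G g -> exists2 z, L z & g = expT z.
Proof. by case=> z Lz <-; exists z. Qed.

Lemma group_coef0 g : G g -> g [bseq] = 1.
Proof. by case/groupP => z Lz ->; exact: expT_coef0. Qed.

Lemma mulVT g : G g -> invT g * g = 1.
Proof. by move/group_coef0/invTK => []. Qed.

Lemma mulTV g : G g -> g * invT g = 1.
Proof. by move/group_coef0/invTK => []. Qed.

Lemma group_invT g : G g -> G (invT g).
Proof.
by case/groupP => z Lz ->; rewrite invT_expT //; apply: group_expT; exact: lieN.
Qed.

Lemma group_tdeg g : G g -> exists2 u, L u & tdeg g = u * g.
Proof. by case/groupP => z Lz ->; exact: tdeg_expT. Qed.

(** From u = D(g - 1) g^{-1}, [u] has order n, so u (g - 1) has order n + 1 and the degree n part of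
    D g = u g reads n g_n = u_n. *)
Lemma tproj_log_derivative n u g : (0 < n)%N -> g [bseq] = 1 ->
  L u -> tdeg g = u * g -> vanishes_below n (g - 1) -> L (tproj n g).
Proof.
move=> n0 g0 Lu gu gn.
have un : vanishes_below n u.
  have -> : u = tdeg (g - 1) * invT g.
    by rewrite tdegB tdeg1 subr0 gu -mulrA (invTK g0).2 mulr1.
  rewrite -[n]addn0; apply: vanishes_belowM => //; exact: vanishes_below_tdeg.
have e : n%:R *: tproj n g = tproj n u.
  rewrite -tproj_tdeg gu -[g in LHS](subrK 1) mulrDr mulr1 tprojD.
  rewrite (@tproj_vanishes _ _ _ n.+1) ?add0r //.
  by rewrite -addn1 addnC; apply: vanishes_belowM => //; exact: lie_vanishes.
rewrite -[tproj n g]scale1r -(@mulVf _ n%:R) ?pnatr_eq0 -?lt0n // -scalerA e.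
by apply: lieZ; exact: lie_tproj.
Qed.

Lemma group_tproj n g : (0 < n)%N -> G g -> vanishes_below n (g - 1) ->
  L (tproj n g).
Proof.
move=> n0 Gg; have [u Lu gu] := group_tdeg Gg.
exact: tproj_log_derivative (group_coef0 Gg) Lu gu.
Qed.

Lemma vanishes_below_exprD n k z q :
  vanishes_below 1 z -> vanishes_below n q -> (0 < n)%N ->
  vanishes_below (n + k) ((z + q) ^+ k.+1 - z ^+ k.+1).
Proof.
move=> z1 qn n0; elim: k => [|k IH].
  by rewrite !expr1 addrAC subrr add0r addn0.
have -> : (z + q) ^+ k.+2 - z ^+ k.+2 =
    (z + q) * ((z + q) ^+ k.+1 - z ^+ k.+1) + q * z ^+ k.+1.
  by rewrite mulrBr -!exprS [(z + q) * z ^+ _]mulrDl -exprS opprD addrA subrK.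
apply: vanishes_belowD.
  rewrite addnS -add1n; apply: vanishes_belowM => //.
  by apply: vanishes_belowD => //; exact: vanishes_belowW qn.
apply: vanishes_belowM => //; have := vanishes_belowX (k := k.+1) z1.
by rewrite muln1.
Qed.

(** Only the linear term of the exponential sees [q] in degree n: a change of z by order n moves the
    (i+1)-st power by order n + i. *)
Lemma vanishes_below_expTD n z q : (0 < m)%N ->
  vanishes_below 1 z -> vanishes_below n q -> (0 < n)%N ->
  vanishes_below n.+1 (expT (z + q) - expT z - q).
Proof.
move=> m0 z1 qn n0; rewrite !expTE -sumrB big_ord_recl !expterm0 subrr add0r.
rewrite (bigD1 (Ordinal m0)) // lift0 addrAC.
apply: vanishes_belowD.
  rewrite /expterm !expr1 -[(_.+1)`!]/1%N invr1 !scale1r (addrC z) addrK subrr.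
  exact: vanishes_below_zero.
apply: vanishes_below_sum => i i0; rewrite /expterm -scalerBr.
apply: vanishes_belowZ; rewrite lift0.
apply: (@vanishes_belowW _ _ _ (n + i)%N); last exact: vanishes_below_exprD.
by rewrite -addn1 leq_add2l lt0n; apply: contra i0 => /eqP i0; apply/eqP/val_inj.
Qed.

Definition log_derivative g := g [bseq] = 1 /\ exists2 u, L u & tdeg g = u * g.

Lemma group_log_derivative g : G g -> log_derivative g.
Proof. by move=> Gg; split; [exact: group_coef0|exact: group_tdeg]. Qed.

(** By the derivation rule the logarithmic derivatives add up, that of [h] being conjugated by
    exp(z). *)
Lemma log_derivative_expTM z h : L z -> log_derivative h ->
  log_derivative (expT z * h).
Proof.
move=> Lz [h0 [u Lu hu]]; split.
  by rewrite tmul_coef0 expT_coef0 // h0 mulr1.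
have [w Lw zw] := tdeg_expT Lz; have [v Lv zv] := conj_expT Lz Lu.
exists (w + v); first exact: lieD.
by rewrite tdegM zw hu mulrA zv -!mulrA -mulrDl.
Qed.

(* The condition on [tdeg g] is linear in [g] and makes [G] closed under
   products without the Baker-Campbell-Hausdorff formula. *)
Lemma log_derivative_group g : (0 < m)%N -> log_derivative g -> G g.
Proof.
move=> m0 gG.
suff [z Lz gz] : exists2 z, L z & vanishes_below m.+1 (g - expT z).
  have /eqP := vanishes_below_eq0 (ltnSn m) gz; rewrite subr_eq0 => /eqP ->.
  exact: group_expT.
(* The logarithm of g is built degree by degree: the leading term [q] of exp(- z) g - 1 is in the
   Lie algebra, and z + q is correct one degree further. *)
suff H : forall n, exists2 z, L z & vanishes_below n.+1 (g - expT z) by exact: H.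
elim=> [|n [z Lz gz]].
  exists 0; first exact: lie0.
  by apply/vanishes_below1P; rewrite !tcoefE (expT_coef0 (@lie0 _ V m)) gG.1 subrr.
have [h0 [u Lu hu]] := log_derivative_expTM (lieN Lz) gG.
set h := expT (- z) * g in h0 hu.
have zz1 := expTN (lie_vanishes Lz).
have hE : h - 1 = expT (- z) * (g - expT z) by rewrite mulrBr zz1.
have hn : vanishes_below n.+1 (h - 1).
  by rewrite hE -[n.+1]add0n; exact: vanishes_belowM.
have Lq := tproj_log_derivative (ltn0Sn n) h0 Lu hu hn.
set q := tproj n.+1 h in Lq.
exists (z + q); first exact: lieD.
have qn : vanishes_below n.+1 q by exact: vanishes_below_tproj.
have gE : g = expT z * h.
  have := expTN (lie_vanishes (lieN Lz)); rewrite opprK /h mulrA => ->.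
  by rewrite mul1r.
have qE : q = tproj n.+1 (h - 1).
  rewrite tprojD -scaleN1r tprojZ (@tproj_homogeneous _ _ _ _ 0 1); last first.
    by rewrite tdeg1 scale0r.
  by rewrite (_ : (0 == n.+1)%N%:R = 0) // scale0r scaler0 addr0.
have -> : g - expT (z + q) = (h - 1 - q) + (expT z - 1) * (h - 1)
    - (expT (z + q) - expT z - q).
  rewrite {1}gE mulrBl mulrBr !mul1r mulr1; apply: talgP => w.
  by rewrite !tcoefE; ring.
apply: vanishes_belowB; last first.
  by apply: vanishes_below_expTD => //; exact: lie_vanishes.
apply: vanishes_belowD; first by rewrite qE; exact: vanishes_belowS_tproj.
rewrite -add1n; apply: vanishes_belowM => //.
by apply/vanishes_below1P; rewrite !tcoefE expT_coef0 // subrr.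
Qed.

Lemma groupM g h : (0 < m)%N -> G g -> G h -> G (g * h).
Proof.
move=> m0 /groupP[z Lz ->] /group_log_derivative hG.
by apply: log_derivative_group => //; exact: log_derivative_expTM.
Qed.

Lemma tdil_expT t z : tdil t (expT z) = expT (tdil t z).
Proof.
rewrite !expTE tdil_sum; apply: eq_bigr => k _.
by rewrite /expterm tdilZ tdilX.
Qed.

End NilpotentGroup.

(** * Bounding the homogeneous norm by coordinates *)

Section NormBound.
Context {R : realType} (V : finNormedModType R) (m : nat).
Local Notation T := (talg V m).
Local Notation word := (word V m).
Local Notation L := (@free_nilpotent_lie R V m : T -> Prop).
Local Notation G := (@free_nilpotent_group R V m : T -> Prop).
Implicit Types (a b g h : T) (c t : R).

(** A bound compatible with dilations: [t] is the scale and [c] a constant. Sums and products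
    enlarge [c] and keep [t]. *)
Definition hbounded a c t : Prop := forall w : word, `|a w| <= c * t ^+ size w.

Lemma hboundedW a c c' t : 0 <= t -> c <= c' -> hbounded a c t -> hbounded a c' t.
Proof.
move=> t0 cc ac w; apply: (le_trans (ac w)).
by rewrite ler_wpM2r // exprn_ge0.
Qed.

Lemma hbounded1 t : 0 <= t -> hbounded 1 1 t.
Proof.
move=> t0 w; rewrite tone_coef mul1r; case: eqP => [->|_].
  by rewrite expr0 normr1.
by rewrite normr0 exprn_ge0.
Qed.

Lemma hboundedD a b c c' t :
  hbounded a c t -> hbounded b c' t -> hbounded (a + b) (c + c') t.
Proof.
move=> ac bc w; rewrite tadd_coef mulrDl.
by apply: (le_trans (ler_normD _ _)); exact: lerD.
Qed.

Lemma hboundedN a c t : hbounded a c t -> hbounded (- a) c t.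
Proof. by move=> ac w; rewrite topp_coef normrN. Qed.

Lemma hboundedZ a c (k : R) t : hbounded a c t -> hbounded (k *: a) (`|k| * c) t.
Proof.
by move=> ac w; rewrite tscale_coef normrM -mulrA; apply: ler_wpM2l.
Qed.

Lemma hboundedM a b c c' t : 0 <= t -> 0 <= c -> 0 <= c' ->
  hbounded a c t -> hbounded b c' t ->
  hbounded (a * b) ((#|word| * #|word|)%:R * (c * c')) t.
Proof.
move=> t0 c0 c'0 ac bc w; rewrite tmul_coef.
have cst : (#|word| * #|word|)%:R * (c * c') * t ^+ size w =
    \sum_(u : word) \sum_(v : word) c * c' * t ^+ size w.
  by rewrite !sumr_const -mulrnA -!mulrA mulr_natl.
rewrite cst; apply: (le_trans (ler_norm_sum _ _ _)); apply: ler_sum => u _.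
apply: (le_trans (ler_norm_sum _ _ _)); apply: ler_sum => v _.
case: eqP => [<-|_]; last first.
  rewrite mul0r normr0. by rewrite mulr_ge0 ?exprn_ge0 // mulr_ge0.
rewrite mul1r size_cat exprD normrM mulrACA; exact: ler_pM.
Qed.

Lemma hboundedX c k : 0 <= c ->
  exists2 c', 0 <= c' & forall a t, 0 <= t -> hbounded a c t -> hbounded (a ^+ k) c' t.
Proof.
move=> c0; elim: k => [|k [c' c'0 IH]].
  by exists 1 => // a t t0 _; rewrite expr0; exact: hbounded1.
exists ((#|word| * #|word|)%:R * (c * c')); first by rewrite !mulr_ge0.
by move=> a t t0 ac; rewrite exprS; apply: hboundedM => //; exact: IH.
Qed.

(** The new constant is fixed before [a] and [t]; the linear bound in [norm_le] rests on this
    uniformity. *)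
Lemma hbounded_series (alpha : nat -> R) c n : 0 <= c ->
  exists2 c', 0 <= c' & forall a t, 0 <= t -> hbounded a c t ->
    hbounded (\sum_(k < n) alpha k *: a ^+ k) c' t.
Proof.
move=> c0; elim: n => [|n [c' c'0 IH]].
  exists 0 => // a t t0 _ w.
  by rewrite big_ord0 tzero_coef normr0 mul0r.
have [d d0 dX] := hboundedX n c0.
exists (c' + `|alpha n| * d); first by rewrite addr_ge0 // mulr_ge0.
move=> a t t0 ac; rewrite big_ord_recr; apply: hboundedD; first exact: IH.
by apply: hboundedZ; exact: dX.
Qed.

Lemma hbounded_expT c : 0 <= c ->
  exists2 c', 0 <= c' & forall a t, 0 <= t -> hbounded a c t ->
    hbounded (expT a) c' t.
Proof.
move=> /(hbounded_series (fun k => k`!%:R^-1) m.+1)[c' c'0 cc'].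
by exists c' => // a t t0 /cc'; rewrite expTE; exact.
Qed.

Lemma hbounded_invT c : 0 <= c ->
  exists2 c', 0 <= c' & forall g t, 0 <= t -> hbounded g c t ->
    hbounded (invT g) c' t.
Proof.
move=> c0; have [|c' c'0 cc'] := @hbounded_series (fun=> 1) (1 + c) m.+1.
  by rewrite addr_ge0.
exists c' => // g t t0 gc.
have -> : invT g = \sum_(k < m.+1) 1 *: (1 - g) ^+ k.
  by apply: eq_bigr => k _; rewrite texpnE scale1r.
by apply: cc' => //; exact: hboundedD (hbounded1 t0) (hboundedN gc).
Qed.

Lemma hbounded_homogeneous n b : tdeg b = n%:R *: b ->
  exists2 B, 0 <= B & forall c t k, 0 <= t -> 0 <= c -> `|k| <= c * t ^+ n ->
    hbounded (k *: b) (c * B) t.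
Proof.
move=> bn; exists (\sum_(w : word) `|b w|); first exact: sumr_ge0.
move=> c t k t0 c0 kc w; rewrite tscale_coef normrM.
have := congr1 (fun x : T => x w) bn; rewrite tdeg_coef tscale_coef => /eqP.
rewrite -subr_eq0 -mulrBl mulf_eq0 subr_eq0 eqr_nat => /orP[/eqP ->|/eqP ->].
  rewrite mulrAC; apply: ler_pM => //.
  by rewrite (bigD1 w) //= lerDl sumr_ge0.
by rewrite normr0 mulr0 !mulr_ge0 ?exprn_ge0 // sumr_ge0.
Qed.

Lemma tprojB1 n g : (0 < n)%N -> tproj n (g - 1) = tproj n g.
Proof.
move=> n0; apply: talgP => w; rewrite !tproj_coef !tcoefE.
case: (eqVneq (size w) n) => [wn|_]; last by rewrite !mul0r.
by rewrite wn (gtn_eqF n0) subr0.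
Qed.

Lemma expT0 : expT 0 = 1 :> T.
Proof.
rewrite expTE big_ord_recl expterm0 big1 ?addr0 // => i _.
by rewrite /expterm exprS mul0r scaler0.
Qed.

Variable N : T -> R.
Hypothesis (m0 : (0 < m)%N) (hN : homogeneous_norm (N : tensor V m -> R)).

Lemma norm_ge0 g : G g -> 0 <= N g.
Proof. by case: hN => H _ _ _ _; exact: H. Qed.

Lemma norm1 : N 1 = 0.
Proof.
case: hN => _ H _ _ _; apply/H => //.
by exists 0; [exact: lie0|exact: expT0].
Qed.

Lemma normM g h : G g -> G h -> N (g * h) <= N g + N h.
Proof. by case: hN => _ _ _ H _; exact: H. Qed.

Lemma norm_invT g : G g -> N (invT g) = N g.
Proof. by case: hN => _ _ _ _ H; exact: H. Qed.

Lemma norm_tdil t g : G g -> N (tdil t g) = `|t| * N g.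
Proof. by case: hN => _ _ H _ _; exact: H. Qed.

(** For k >= 0, exp(k b) is the dilate of exp(b) by the n-th root of k; a negative k is reduced to
    this by symmetry of the norm. *)
Lemma norm_expT_homogeneous n b k c t : (0 < n)%N -> L b -> tdeg b = n%:R *: b ->
  0 <= t -> 1 <= c -> `|k| <= c * t ^+ n ->
  N (expT (k *: b)) <= c * t * N (expT b).
Proof.
move=> n0 Lb bn t0 c1 kc; have c0 : 0 <= c by exact: le_trans c1.
have Nb : 0 <= N (expT b) by apply: norm_ge0; exact: group_expT.
pose s := `|k| `^ n%:R^-1.
have sn : s ^+ n = `|k|.
  rewrite -powR_mulrn ?powR_ge0 // -powRrM mulVf ?powRr1 //.
  by rewrite pnatr_eq0 -lt0n.
(* Since 1 <= c, c t^n <= (c t)^n. *)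
have sct : s <= c * t.
  rewrite -(@ler_pXn2r _ n) ?nnegrE ?powR_ge0 ?mulr_ge0 // sn (le_trans kc) //.
  rewrite exprMn ler_wpM2r ?exprn_ge0 //.
  by rewrite -[leLHS]expr1 ler_weXn2l.
have Ns : N (expT (`|k| *: b)) <= c * t * N (expT b).
  rewrite -sn -tdil_homogeneous // -tdil_expT norm_tdil; last exact: group_expT.
  by rewrite ger0_norm ?powR_ge0 // ler_wpM2r.
case: (lerP 0 k) => [k0|k0]; first by rewrite ger0_norm in Ns.
rewrite ltr0_norm // scaleNr in Ns.
have Lk : L (k *: b) by exact: lieZ.
rewrite -norm_invT; last exact: group_expT.
by rewrite invT_expT.
Qed.

(* The exponentials of the terms of the degree [n] part are factored out one at
   a time, the remainder being an element of higher order. *)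
Lemma norm_le_step n (r : seq word) : (0 < n)%N -> all (fun w : word => size w == n) r ->
  (forall c, 0 <= c -> exists2 C, 0 <= C & forall t g, 0 <= t -> G g ->
     vanishes_below n.+1 (g - 1) -> hbounded g c t -> N g <= C * t) ->
  forall c, 0 <= c -> exists2 C, 0 <= C & forall t g (k : word -> R),
    0 <= t -> G g -> vanishes_below n (g - 1) ->
    (forall w, `|k w| <= c * t ^+ n) ->
    tproj n g = \sum_(w <- r) k w *: rbracket m w -> hbounded g c t ->
    N g <= C * t.
Proof.
move=> n0 + IHn; elim: r => [_|w r IH /= /andP[/eqP wn rn]] c c0.
  have [C C0 H] := IHn c c0; exists C => // t g k t0 Gg gn _ gk gc.
  apply: H => //; have := vanishes_belowS_tproj gn.
  by rewrite tprojB1 // gk big_nil subr0.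
pose b := rbracket m w.
have Lb : L b by exact: lie_rbracket.
have bn : tdeg b = n%:R *: b by rewrite tdeg_rbracket wn.
have [B B0 hB] := hbounded_homogeneous bn.
have [c1 c10 hexp] := hbounded_expT (mulr_ge0 c0 B0).
pose c2 := (#|word| * #|word|)%:R * (c1 * c).
have c20 : 0 <= c2 by rewrite !mulr_ge0.
(* One constant has to bound both the coefficients [k] (by [c]) and the coordinates of the new
   element [h] (by [c2]). *)
have [C C0 HC] := IH rn (c + c2) (addr_ge0 c0 c20).
have NB0 : 0 <= N (expT b) by apply: norm_ge0; exact: group_expT.
(* The factor 1 + c stands for c because [norm_expT_homogeneous] wants a constant at least 1. *)
exists ((1 + c) * N (expT b) + C); first by rewrite addr_ge0 ?mulr_ge0 ?addr_ge0.
move=> t g k t0 Gg gn kc gk gc.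
(* Multiplying g by exp(q) cancels the term of [w] in the degree n part and changes nothing else
   there. *)
pose q := - k w *: b.
have Lq : L q by exact: lieZ.
have qn : vanishes_below n q.
  apply: vanishes_belowZ => v vn; have := congr1 (fun x : T => x v) bn.
  rewrite tdeg_coef tscale_coef => /eqP.
  rewrite -subr_eq0 -mulrBl mulf_eq0 subr_eq0 eqr_nat => /orP[/eqP e|/eqP //].
  by move: vn; rewrite e ltnn.
have eq : vanishes_below n.+1 (expT q - 1 - q).
  have := vanishes_below_expTD m0 (@vanishes_below_zero _ V m 1) qn n0.
  by rewrite add0r expT0.
have e1 : vanishes_below n (expT q - 1).
  rewrite -[_ - 1](subrK q); apply: vanishes_belowD => //.
  exact: vanishes_belowW eq.
pose h := expT q * g.
have Gh : G h by apply: groupM => //; exact: group_expT.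
have hE : h - 1 = (expT q - 1 - q + (expT q - 1) * (g - 1)) + (q + (g - 1)).
  rewrite /h mulrBl mulrBr !mul1r mulr1; apply: talgP => v; rewrite !tcoefE; ring.
have hn1 : vanishes_below n.+1 (expT q - 1 - q + (expT q - 1) * (g - 1)).
  apply: vanishes_belowD => //; apply: (@vanishes_belowW _ _ _ (n + n)%N).
    by rewrite -addn1 leq_add2l.
  exact: vanishes_belowM.
have Ng : N g <= N (expT (k w *: b)) + N h.
  have -> : g = expT (k w *: b) * h.
    have := expTN (lie_vanishes Lq).
    by rewrite {1}/q scaleNr opprK /h mulrA => ->; rewrite mul1r.
  by apply: normM => //; apply: group_expT; exact: lieZ.
rewrite mulrDl mulrAC; apply: (le_trans Ng); apply: lerD.
  apply: (norm_expT_homogeneous n0 Lb bn t0); first by rewrite lerDl.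
  have c1c : c <= 1 + c by rewrite lerDr ler01.
  exact: le_trans (kc w) (ler_wpM2r (exprn_ge0 n t0) c1c).
apply: (HC t h k) => //.
- have hn : vanishes_below n (h - 1).
    rewrite hE; apply: vanishes_belowD; first exact: vanishes_belowW hn1.
    exact: vanishes_belowD.
  exact: hn.
- move=> v; have cc2 : c <= c + c2 by rewrite lerDl.
  exact: le_trans (kc v) (ler_wpM2r (exprn_ge0 n t0) cc2).
- rewrite -tprojB1 // hE tprojD (tproj_vanishes (n := n.+1)) // add0r tprojD.
  rewrite tprojB1 // gk big_cons addrA /q tprojZ (tproj_homogeneous n bn) eqxx.
  by rewrite scale1r scaleNr addNr add0r.
- apply: (@hboundedW _ c2) => //; first by rewrite lerDr.
  apply: hboundedM => //; apply: hexp => //.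
  by apply: hB => //; rewrite normrN.
Qed.

(** Induction lowering the order of g - 1, from m + 1, where g = 1, to 1, which every group element
    satisfies. *)
Lemma norm_le c : 0 <= c -> exists2 C, 0 <= C & forall t g, 0 <= t -> G g ->
  hbounded g c t -> N g <= C * t.
Proof.
have H n : (n <= m)%N -> forall c, 0 <= c ->
    exists2 C, 0 <= C & forall t g, 0 <= t -> G g ->
      vanishes_below (m.+1 - n) (g - 1) -> hbounded g c t -> N g <= C * t.
  elim: n => [_ d d0|n IH nm d d0].
    exists 0 => // t g t0 Gg; rewrite subn0.
    move=> /(vanishes_below_eq0 (ltnSn m))/eqP; rewrite subr_eq0 => /eqP -> _.
    by rewrite norm1 mul0r.
  rewrite subSS; set k := (m - n)%N.
  have k0 : (0 < k)%N by rewrite subn_gt0.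
  have [||C C0 HC] := @norm_le_step k [seq w : word <- enum {: word} | size w == k] k0 _ _ d d0.
  - by apply/allP => w; rewrite mem_filter => /andP[].
  - move=> e e0; have [C C0 HC] := IH (ltnW nm) e e0; exists C => //.
    by move=> t g t0 Gg; rewrite -subSn 1?ltnW //; exact: HC.
  exists C => // t g t0 Gg gk gd.
  have Lk := group_tproj k0 Gg gk.
  (* The coefficients of Dynkin's formula, set to 0 in other degrees because the bound is required
     of all words. *)
  apply: (HC t g (fun w => if size w == k then k%:R^-1 * g w else 0)) => //.
    move=> w; case: eqP => [wk|_]; last by rewrite normr0 mulr_ge0 ?exprn_ge0.
    rewrite normrM; apply: (@le_trans _ _ `|g w|); last by have := gd w; rewrite wk.
    by apply: ler_piMl => //; rewrite normfV normr_nat invf_le1 ?ltr0n // ler1n.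
  rewrite big_filter big_enum_cond /=.
  (* The formula holds in the Lie algebra, which contains the leading part of g but not g. *)
  have -> : tproj k g = tproj k (tproj k g).
    by apply: talgP => w; rewrite !tproj_coef; case: eqP; rewrite ?mul1r ?mul0r.
  rewrite tproj_lieE //; apply: eq_big => [w|w /eqP wk]; first by [].
  by rewrite tproj_coef wk eqxx mul1r.
move=> c0; have [C C0 HC] := H m (leqnn m) c c0.
exists C => // t g t0 Gg; apply: HC => //.
by rewrite subSn // subnn; apply/vanishes_below1P; rewrite !tcoefE group_coef0 ?subrr.
Qed.

End NormBound.

Local Open Scope classical_set_scope.
Local Open Scope ring_scope.

(** * Primitives and derivatives of real functions *)

Section Primitive.
Context {R : realType}.
Local Notation mu := (@lebesgue_measure R).
Implicit Types (g : R -> R) (a s t x : R).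

Lemma derivable_continuous g (dg : R) x : is_derive x 1 g dg -> {for x, continuous g}.
Proof.
by move=> gx; apply/differentiable_continuous/derivable1_diffP; exact: ex_derive.
Qed.

Definition primitive a g x : R := \int[mu]_(u in `[a, x]) g u.

Lemma within_continuous a b g : (forall x, a <= x -> {for x, continuous g}) ->
  {within `[a, b]%classic, continuous g}.
Proof.
move=> gc; apply: continuous_in_subspaceT => x; rewrite inE /= in_itv /=.
by move=> /andP[ax _]; exact: gc.
Qed.

Lemma is_derive_primitive a g x :
  (forall x, a <= x -> {for x, continuous g}) -> a < x ->
  is_derive x 1 (primitive a g) (g x).
Proof.
(* The right end x + 1 puts x inside the interval. *)
move=> gc ax; have [|||d e] := @continuous_FTC1_closed R g a x (x + 1) _ _ ax.
- by rewrite ltrDl.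
- apply: continuous_compact_integrable; first exact: segment_compact.
  exact: within_continuous.
- by apply: gc; exact: ltW.
apply: (DeriveDef d); exact: etrans (esym (derive1E _ _)) e.
Qed.

(** A base point strictly left of [s] makes the primitive differentiable, hence continuous, at [s]
    itself. *)
Lemma primitiveB a g s t :
  (forall x, a <= x -> {for x, continuous g}) -> a < s -> s <= t ->
  \int[mu]_(u in `[s, t]) g u = primitive a g t - primitive a g s.
Proof.
move=> gc as_; rewrite le_eqVlt => /predU1P[<-|st].
  by rewrite subrr set_itv1 Rintegral_set1.
have P x : a < x -> is_derive x 1 (primitive a g) (g x) by exact: is_derive_primitive.
have Pc x : a < x -> {for x, continuous (primitive a g)}.
  by move=> /P; exact: derivable_continuous.
rewrite /Rintegral (@continuous_FTC2 _ g (primitive a g) s t st) //.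
- by apply: within_continuous => x sx; apply: gc; rewrite (le_trans (ltW as_)).
- split.
  + move=> x; rewrite in_itv /= => /andP[sx _].
    by have := P x (lt_trans as_ sx) => -[].
  + by apply: cvg_at_right_filter; exact: Pc.
  + by apply: cvg_at_left_filter; apply: Pc; exact: lt_trans st.
- move=> x; rewrite in_itv /= => /andP[sx _].
  by rewrite derive1E; apply: derive_val; exact: P (lt_trans as_ sx).
Qed.

Lemma is_derive_bigsum I (r : seq I) (P : pred I) (F : I -> R -> R) (dF : I -> R) x :
  (forall i, P i -> is_derive x 1 (F i) (dF i)) ->
  is_derive x 1 (fun s => \sum_(i <- r | P i) F i s) (\sum_(i <- r | P i) dF i).
Proof.
move=> FdF; elim: r => [|i r IH].
  rewrite big_nil (_ : (fun s => _) = cst 0); last first.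
    by apply/funext => s; rewrite big_nil.
  exact: is_derive_cst.
rewrite big_cons; case: ifP => Pi; last first.
  rewrite (_ : (fun s => _) = (fun s => \sum_(i <- r | P i) F i s)) //.
  by apply/funext => s; rewrite big_cons Pi.
rewrite (_ : (fun s => _) = F i + (fun s => \sum_(i <- r | P i) F i s)).
  by apply: is_deriveD; exact: FdF.
by apply/funext => s; rewrite big_cons Pi.
Qed.

Lemma is_derive_scale (k : R) g (dg : R) x :
  is_derive x 1 g dg -> is_derive x 1 (fun s => k * g s) (k * dg).
Proof. exact: is_deriveZ. Qed.

Lemma is_derive_mul g (dg : R) g' (dg' : R) x :
  is_derive x 1 g dg -> is_derive x 1 g' dg' ->
  is_derive x 1 (fun s => g s * g' s) (dg * g' x + g x * dg').
Proof.
move=> gd gd'; have := is_deriveM gd gd'.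
by rewrite addrC [X in is_derive _ _ _ (X + _)]mulrC.
Qed.

End Primitive.

(** * Linear differential equations in the tensor algebra *)

Section TensorDerivative.
Context {R : realType} (V : finNormedModType R) (m : nat).
Local Notation T := (talg V m).
Local Notation word := (word V m).
Local Notation L := (@free_nilpotent_lie R V m : T -> Prop).
Local Notation G := (@free_nilpotent_group R V m : T -> Prop).
Implicit Types (X dX v : R -> T) (x s t : R).

(** The domain extends left of 0 so that two-sided derivatives exist at 0. *)
Definition tderive X dX : Prop := forall x, -1 < x -> forall w : word,
  is_derive x 1 (fun s => X s w : R) (dX x w).

Lemma tderive_cst (a : T) : tderive (fun=> a) (fun=> 0).
Proof. by move=> x _ w; rewrite tzero_coef; exact: is_derive_cst. Qed.

Lemma tderiveM X dX Y dY : tderive X dX -> tderive Y dY ->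
  tderive (fun s => X s * Y s) (fun s => dX s * Y s + X s * dY s).
Proof.
move=> Xd Yd x x1 w; rewrite tadd_coef !tmul_coef.
rewrite (_ : (fun s => _) = (fun s => \sum_(u : word) \sum_(v : word)
   (u ++ v == w :> seq _)%:R * (X s u * Y s v))); last first.
  by apply/funext => s; rewrite tmul_coef.
rewrite -big_split; apply: is_derive_bigsum => u _.
rewrite -big_split; apply: is_derive_bigsum => v _ /=.
by rewrite -mulrDr; apply: is_derive_scale; apply: is_derive_mul; [exact: Xd|exact: Yd].
Qed.

Lemma tderiveB X dX Y dY : tderive X dX -> tderive Y dY ->
  tderive (fun s => X s - Y s) (fun s => dX s - dY s).
Proof.
move=> Xd Yd x x1 w; rewrite tadd_coef topp_coef.
rewrite (_ : (fun s => _) = (fun s => X s w) - (fun s => Y s w)); last first.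
  by apply/funext => s; rewrite tadd_coef topp_coef.
by apply: is_deriveB; [exact: Xd|exact: Yd].
Qed.

Lemma tderive_tdeg X dX : tderive X dX ->
  tderive (fun s => tdeg (X s)) (fun s => tdeg (dX s)).
Proof.
move=> Xd x x1 w; rewrite tdeg_coef.
rewrite (_ : (fun s => _) = (fun s => (size w)%:R * X s w)); last first.
  by apply/funext => s; rewrite tdeg_coef.
by apply: is_derive_scale; exact: Xd.
Qed.

Lemma tderive_dynkin X dX : tderive X dX ->
  tderive (fun s => dynkin (X s)) (fun s => dynkin (dX s)).
Proof.
move=> Xd x x1 w; rewrite /dynkin tsum_coef.
rewrite (_ : (fun s => _) = (fun s =>
    \sum_(u : word) rbracket m u w * X s u)); last first.
  apply/funext => s; rewrite tsum_coef; apply: eq_bigr => u _.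
  by rewrite tscale_coef mulrC.
under eq_bigr => u _ do rewrite tscale_coef mulrC.
by apply: is_derive_bigsum => u _; apply: is_derive_scale; exact: Xd.
Qed.

Lemma tderive_continuous X dX w a b : tderive X dX -> 0 <= a ->
  {within `[a, b]%classic, continuous (fun s => X s w : R)}.
Proof.
move=> Xd a0; apply: within_continuous => x ax.
apply: derivable_continuous; apply: Xd.
by rewrite (lt_le_trans _ (le_trans a0 ax)) // ltrN10.
Qed.

Lemma tderive_MVT X dX w s t : tderive X dX -> 0 <= s -> s <= t ->
  exists2 c, s <= c <= t & X t w - X s w = dX c w * (t - s).
Proof.
move=> Xd s0 st.
have [||c cst e] := @MVT_segment _ (fun r => X r w : R) (fun r => dX r w) s t st.
- move=> x; rewrite in_itv /= => /andP[sx _]; apply: Xd.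
  by rewrite (lt_trans _ (le_lt_trans s0 sx)) // ltrN10.
- exact: (tderive_continuous (b := t) Xd s0).
by exists c; first by move: cst; rewrite in_itv.
Qed.

(** The difference Z satisfies Z' = - v Z and Z(t) = 0. As [v] raises degrees, vanishing of Z below
    n makes Z' vanish below n + 1, so uniqueness is an induction on the degree. *)
Lemma flow_unique v X Y c t : (forall s, vanishes_below 1 (v s)) -> 0 <= t ->
  tderive X (fun s => c s - v s * X s) -> tderive Y (fun s => c s - v s * Y s) ->
  X t = Y t -> forall s, 0 <= s -> s <= t -> X s = Y s.
Proof.
move=> v1 t0 Xd Yd XYt.
have Zd := tderiveB Xd Yd.
suff H n : forall s, 0 <= s -> s <= t -> vanishes_below n (X s - Y s).
  move=> s s0 st; apply/eqP; rewrite -subr_eq0; apply/eqP.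
  by apply: (vanishes_below_eq0 (ltnSn m)); exact: H.
elim: n => [//|n IH] s s0 st w wn.
have [r /andP[sr rt] e] := tderive_MVT w Zd s0 st.
have eZ : c r - v r * X r - (c r - v r * Y r) = - (v r * (X r - Y r)).
  by rewrite mulrBr; apply: talgP => w'; rewrite !tcoefE; ring.
have : (X t - Y t) w - (X s - Y s) w = 0.
  rewrite e eZ topp_coef (@vanishes_belowM _ _ _ 1 n) ?oppr0 ?mul0r //.
  by apply: IH => //; exact: le_trans sr.
rewrite XYt subrr tzero_coef sub0r => /eqP; rewrite oppr_eq0 => /eqP.
exact.
Qed.

End TensorDerivative.

(** * Signatures of smooth paths as group elements *)

Section Signature.
Context {R : realType} (V : finNormedModType R) (m : nat).
Local Notation T := (talg V m).
Local Notation word := (word V m).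
Local Notation letter := 'I_(\dim {:V}).
Local Notation L := (@free_nilpotent_lie R V m : T -> Prop).
Local Notation G := (@free_nilpotent_group R V m : T -> Prop).
Implicit Types (w : word) (s t x u : R).

Definition vecT (v : V) : T := tvec m v.

Lemma vecTE v : vecT v = \sum_i vcoord i v *: tletter m i.
Proof. exact: tvecE. Qed.

Lemma lie_vecT v : L (vecT v). Proof. exact: lie_vec. Qed.

Lemma vecTM_coef0 v (b : T) : (vecT v * b) [bseq] = 0.
Proof. by rewrite tmul_coef0 (lie_vanishes (lie_vecT v)) // mul0r. Qed.

Lemma vecTM_coef v (b : T) i l w : val w = i :: l ->
  (vecT v * b) w = vcoord i v * b (insubd [bseq] l).
Proof.
move=> wil; rewrite vecTE mulr_suml tsum_coef.
have lm : (size l <= m)%N.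
  by have := size_bseq w; rewrite -[size _]/(size (val w)) wil; exact: ltnW.
under eq_bigr => j _.
  rewrite -scalerAl tscale_coef tletterM_coef -[bseqval w]/(val w) wil.
  over.
rewrite (bigD1 i) //= [X in _ + X]big1 ?addr0 => [|j ji].
  congr (_ * _); rewrite -[RHS](sum_word b lm); apply: eq_bigr => u _.
  by rewrite eqseq_cons eqxx eq_sym.
by rewrite big1 ?mulr0 // => u _; rewrite eqseq_cons (negPf ji) mul0r.
Qed.

Lemma tdeg_vecT v : tdeg (vecT v) = vecT v.
Proof.
rewrite vecTE tdeg_sum; apply: eq_bigr => i _.
by rewrite tdegZ tdeg_letter.
Qed.

Lemma dynkin1 : dynkin (1 : T) = 0.
Proof.
rewrite /dynkin big1 // => w _; rewrite tone_coef size_eq0.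
by case: eqP => [->|_]; rewrite ?scaler0 ?scale0r.
Qed.

(* Each primitive costs an interval of definition to the left of [0]; starting
   from [- (m + 1)] leaves all words of length at most [m] smooth on [-1, +oo[. *)
Fixpoint sig_coef (y : R -> V) t (l : seq letter) : R -> R :=
  if l is i :: l' then
    let g u := vcoord i (derive1 y u) * sig_coef y t l' u in
    let P := primitive ((size l')%:R - m.+1%:R) g in
    fun x => P t - P x
  else cst 1.

(* Locked because comparing two signatures by unfolding the integrals diverges. *)
Definition left_signature_def (y : R -> V) t x : T :=
  [ffun w : word => sig_coef y t w x].
Fact left_signature_key : unit. Proof. exact: tt. Qed.
Definition left_signature := locked_with left_signature_key left_signature_def.
Canonical left_signature_unlockable := [unlockable of left_signature].

Lemma left_signature_coef y t x w : left_signature y t x w = sig_coef y t w x.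
Proof. by rewrite [left_signature]unlock ffunE. Qed.

Variable y : R -> V.
Hypothesis yc : forall i, continuous (fun u => vcoord i (derive1 y u)).

Local Notation sigF := (sig_coef y).
Local Notation sigT := (left_signature y).

(** The bound on x is the base point of the primitive for [l]; each shorter word is differentiable
    one unit further left, so its integrand is continuous at that point. *)
Lemma is_derive_sigF t l x : (size l)%:R - m.+2%:R < x ->
  is_derive x 1 (sigF t l)
    (if l is i :: l' then - (vcoord i (derive1 y x) * sigF t l' x) else 0).
Proof.
elim: l x => [|i l IH] x lx /=; first exact: is_derive_cst.
pose g u := vcoord i (derive1 y u) * sigF t l u.
pose P := primitive ((size l)%:R - m.+1%:R) g.
rewrite -[X in is_derive _ _ X _]/(cst (P t) - P) -/(g x) -[- g x]sub0r.
apply: is_deriveB; apply: is_derive_primitive.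
  move=> u lu; apply: continuousM; first exact: yc.
  apply: derivable_continuous; apply: IH; apply: lt_le_trans lu.
  by rewrite ltrD2l ltrN2 ltr_nat.
apply: le_lt_trans lx; rewrite -[size (_ :: _)]/(size l).+1.
by rewrite -[(size l).+1%:R]natr1 -[m.+2%:R]natr1; lra.
Qed.

Lemma sigF_continuous t l x : (size l)%:R - m.+2%:R < x ->
  {for x, continuous (sigF t l)}.
Proof. by move=> lx; apply: derivable_continuous; exact: is_derive_sigF. Qed.

Lemma sigF_iterated t l s : (size l <= m)%N -> 0 <= s -> s <= t ->
  sigF t l s = iterated_integral y l s t.
Proof.
elim: l s => [//|i l IH] s lm s0 st /=.
rewrite -primitiveB //; last 2 first.
- move=> u lu; apply: continuousM; first exact: yc.
  apply: sigF_continuous; apply: lt_le_trans lu.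
  by rewrite ltrD2l ltrN2 ltr_nat.
- by apply: lt_le_trans s0; rewrite subr_lt0 ltr_nat ltnS; exact: ltnW.
apply: eq_Rintegral => u; rewrite inE /= in_itv /= => /andP[su ut].
by rewrite IH //; [exact: ltnW|exact: le_trans su].
Qed.

Lemma sigT_signature s t : 0 <= s -> s <= t -> sigT t s = signature m y s t.
Proof.
move=> s0 st; apply: talgP => w; rewrite left_signature_coef [RHS]ffunE.
by rewrite sigF_iterated // size_bseq.
Qed.

Lemma sigTtt t : sigT t t = 1.
Proof.
apply: talgP => w; rewrite left_signature_coef tone_coef.
by case: (bseqval w) => [//|i l] /=; rewrite subrr.
Qed.

Lemma sigT_coef0 t x : sigT t x [bseq] = 1.
Proof. by rewrite left_signature_coef. Qed.

Lemma sigT_coef_nil t x w : val w = [::] -> sigT t x w = 1.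
Proof. by rewrite left_signature_coef -[bseqval w]/(val w) => ->. Qed.

(** The derivative is taken in the left endpoint because the outermost integration variable carries
    the first letter, which left multiplication by the velocity peels off. *)
Lemma tderive_sigT t :
  tderive (sigT t) (fun x => - (vecT (derive1 y x) * sigT t x)).
Proof.
move=> x x1 w; rewrite (_ : (fun s => _) = sigF t w); last first.
  by apply/funext => s; rewrite left_signature_coef.
have wx : (size w)%:R - m.+2%:R < x.
  apply: le_lt_trans x1.
  have wm : (size w)%:R <= m%:R :> R by rewrite ler_nat size_bseq.
  by rewrite -[m.+2%:R]natr1 -[m.+1%:R]natr1; lra.
have := is_derive_sigF t wx; rewrite topp_coef.
case wE : (val w) => [|i l].
  have -> : w = [bseq] by apply: val_inj.
  by rewrite vecTM_coef0 oppr0.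
rewrite (vecTM_coef _ _ wE) left_signature_coef.
rewrite -[bseqval (insubd _ _)]/(val (insubd _ _)) insubdK //.
by have := size_bseq w; rewrite -[size _]/(size (val w)) wE; exact: ltnW.
Qed.

(** With f the signature and v the velocity, D f and dynkin(f) f both solve X' = - v f - v X with
    value 0 at s = t. *)
Lemma sigT_tdeg t s : 0 <= s -> s <= t ->
  tdeg (sigT t s) = dynkin (sigT t s) * sigT t s.
Proof.
move=> s0 st; have t0 : 0 <= t by exact: le_trans st.
pose v x := vecT (derive1 y x); pose f := sigT t.
have df : tderive f (fun x => - (v x * f x)) by exact: tderive_sigT.
have dN (a : T) : dynkin (- a) = - dynkin a by rewrite -sub0r dynkinB dynkin0 sub0r.
have f1 x : vanishes_below 1 (f x - 1).
  by apply/vanishes_below1P; rewrite !tcoefE sigT_coef0 subrr.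
apply: (@flow_unique _ _ _ v (fun x => tdeg (f x)) (fun x => dynkin (f x) * f x)
          (fun x => - (v x * f x)) t) => //.
- by move=> x; apply: lie_vanishes; exact: lie_vecT.
- have -> : (fun x => - (v x * f x) - v x * tdeg (f x)) =
      (fun x => tdeg (- (v x * f x))).
    apply/funext => x; rewrite -[in RHS]sub0r tdegB tdegM tdeg_vecT.
    have -> : tdeg (0 : T) = 0 by have := tdegZ 0 (0 : T); rewrite !scale0r.
    by rewrite sub0r opprD.
  exact: tderive_tdeg.
- have -> : (fun x => - (v x * f x) - v x * (dynkin (f x) * f x)) =
      (fun x => dynkin (- (v x * f x)) * f x + dynkin (f x) * - (v x * f x)).
    apply/funext => x.
    (* The product identity needs zero constant term, so f is split as (f - 1) + 1; the 1
       contributes dynkin(v) = v. *)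
    have dv : dynkin (v x * f x) = tbr (v x) (dynkin (f x)) + v x.
      have [_ vM vv] := lie_dynkinP (lie_vecT (derive1 y x)).
      rewrite -{1}(subrK 1 (f x)) mulrDr mulr1 dynkinD vM // vv tdeg_vecT.
      by rewrite dynkinB dynkin1 subr0.
    rewrite dN dv /tbr.
    rewrite mulNr mulrN !mulrDl !mulNr !mulrA.
    by apply: talgP => w; rewrite !tcoefE; ring.
  by apply: tderiveM => //; exact: tderive_dynkin.
- by rewrite /f sigTtt tdeg1 dynkin1 mul0r.
Qed.

Lemma group_sigT t s : (0 < m)%N -> 0 <= s -> s <= t -> G (sigT t s).
Proof.
move=> m0 s0 st; apply: log_derivative_group => //; split; first exact: sigT_coef0.
by exists (dynkin (sigT t s)); [exact: lie_dynkin|exact: sigT_tdeg].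
Qed.

(** As functions of [r], both sides solve X' = - y' X and agree at r = s. *)
Lemma chen r s t : 0 <= r -> r <= s -> s <= t ->
  sigT t r = sigT s r * sigT t s.
Proof.
move=> r0 rs st; have s0 := le_trans r0 rs.
apply: (@flow_unique _ _ _ (fun x => vecT (derive1 y x)) (sigT t)
  (fun x => sigT s x * sigT t s) (fun=> 0) s) => //.
- by move=> x; apply: lie_vanishes; exact: lie_vecT.
- have -> : (fun x => 0 - vecT (derive1 y x) * sigT t x) =
      (fun x => - (vecT (derive1 y x) * sigT t x)).
    by apply/funext => x; rewrite sub0r.
  exact: tderive_sigT.
- have -> : (fun x => 0 - vecT (derive1 y x) * (sigT s x * sigT t s)) =
      (fun x => - (vecT (derive1 y x) * sigT s x) * sigT t s + sigT s x * 0).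
    by apply/funext => x; rewrite sub0r mulr0 addr0 mulrA mulNr.
  by apply: tderiveM; [exact: tderive_sigT|exact: tderive_cst].
- by rewrite sigTtt mul1r.
Qed.

Lemma increment_signature s t : (0 < m)%N -> 0 <= s -> s <= t ->
  increment (signature m y 0) s t = sigT t s.
Proof.
move=> m0 s0 st.
rewrite /increment -!sigT_signature //; last exact: le_trans st.
rewrite (@chen 0 s t) //.
change (invT (sigT s 0) * (sigT s 0 * sigT t s) = sigT t s).
by rewrite mulrA mulVT ?mul1r //; exact: group_sigT.
Qed.

Lemma sigT_MVT w i l s t : val w = i :: l -> 0 <= s -> s <= t ->
  exists2 c, s <= c <= t &
    sigT t s w = vcoord i (derive1 y c) * sigT t c (insubd [bseq] l) * (t - s).
Proof.
move=> wil s0 st; have [c cst e] := tderive_MVT w (tderive_sigT t) s0 st.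
exists c => //; rewrite -(vecTM_coef _ _ wil).
move: e; rewrite topp_coef mulNr sigTtt tone_coef -[size w]/(size (val w)) wil.
by rewrite sub0r => /oppr_inj.
Qed.

(** By the mean value theorem each letter costs a factor K (t - s). *)
Lemma sigT_le K s t w : 0 <= s -> s <= t -> t <= 1 -> 0 <= K ->
  (forall i u, 0 <= u <= 1 -> `|vcoord i (derive1 y u)| <= K) ->
  `|sigT t s w| <= (K * (t - s)) ^+ size w.
Proof.
move=> + + t1 K0 vK; have [n] := ubnP (size w); elim: n w s => // n IH w s.
case wE : (val w) => [|i l].
  have -> : w = [bseq] by apply: val_inj.
  by rewrite sigT_coef0 normr1.
rewrite /= ltnS => ln s0 st.
have lm : (size l <= m)%N.
  by have := size_bseq w; rewrite -[size _]/(size (val w)) wE; exact: ltnW.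
pose wl : word := insubd [bseq] l.
have sl : size wl = size l by rewrite -[LHS]/(size (val wl)) insubdK.
have [c /andP[sc ct] ->] := sigT_MVT wE s0 st.
have c0 := le_trans s0 sc.
rewrite !normrM [`|t - s|]ger0_norm ?subr_ge0 // mulrAC exprS.
apply: ler_pM => //; first by rewrite mulr_ge0 // subr_ge0.
  by apply: ler_wpM2r; rewrite ?subr_ge0 // vK // c0 (le_trans ct).
have := IH wl c; rewrite sl => /(_ ln c0 ct).
move=> /le_trans; apply; apply: lerXn2r; rewrite ?nnegrE ?mulr_ge0 ?subr_ge0 //.
by apply: ler_wpM2l => //; rewrite lerD2l lerN2.
Qed.

End Signature.

(** * Signatures of paths with close velocities *)

Section SignatureDifference.
Context {R : realType} (V : finNormedModType R) (m : nat).
Local Notation T := (talg V m).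
Local Notation word := (word V m).
Local Notation G := (@free_nilpotent_group R V m : T -> Prop).
Implicit Types (y : R -> V) (K eps s t : R).

Definition velocity y i (u : R) : R := vcoord i (derive1 y u).

(** Replacing one velocity by the other costs eps per letter, whence the factor [size w]. *)
Lemma sigTB_le y1 y2 K eps s t (w : word) :
  (forall i, continuous (velocity y1 i)) -> (forall i, continuous (velocity y2 i)) ->
  1 <= K -> 0 <= eps ->
  (forall i u, 0 <= u <= 1 -> `|velocity y1 i u| <= K) ->
  (forall i u, 0 <= u <= 1 -> `|velocity y2 i u| <= K) ->
  (forall i u, 0 <= u <= 1 -> `|velocity y1 i u - velocity y2 i u| <= eps) ->
  0 <= s -> s <= t -> t <= 1 ->
  `|(left_signature m y1 t s - left_signature m y2 t s) w| <=
    (size w)%:R * eps * (K * (t - s)) ^+ size w.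
Proof.
move=> c1 c2 K1 e0 K1v K2v v12 + + t1.
have K0 : 0 <= K by exact: le_trans K1.
have [n] := ubnP (size w); elim: n w s => // n IH w s.
case wE : (val w) => [|i l].
  move: (sigT_coef_nil y1 t s wE) (sigT_coef_nil y2 t s wE).
  move: (left_signature m y1 t s) (left_signature m y2 t s) => f1 f2 f1w f2w _ _ _.
  by rewrite tadd_coef topp_coef f1w f2w subrr normr0 !mul0r.
rewrite /= ltnS => ln s0 st.
have lm : (size l <= m)%N.
  by have := size_bseq w; rewrite -[size _]/(size (val w)) wE; exact: ltnW.
pose wl : word := insubd [bseq] l.
have sl : size wl = size l by rewrite -[LHS]/(size (val wl)) insubdK.
have dB := tderiveB (tderive_sigT (m := m) c1 t) (tderive_sigT (m := m) c2 t).
have [c /andP[sc ct]] := tderive_MVT w dB s0 st.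
have c0 := le_trans s0 sc; have c01 : 0 <= c <= 1 by rewrite c0 (le_trans ct).
rewrite !sigTtt subrr tzero_coef sub0r => /(congr1 (fun x => `|x|)).
rewrite normrN => ->.
rewrite tadd_coef !topp_coef !(vecTM_coef _ _ wE) -/wl.
rewrite -/(velocity y1 i c) -/(velocity y2 i c).
have -> : - (velocity y1 i c * left_signature m y1 t c wl) -
    - (velocity y2 i c * left_signature m y2 t c wl) =
    - ((velocity y1 i c - velocity y2 i c) * left_signature m y1 t c wl +
       velocity y2 i c * (left_signature m y1 t c - left_signature m y2 t c) wl).
  by rewrite tadd_coef topp_coef; ring.
rewrite normrM normrN [`|t - s|]ger0_norm ?subr_ge0 //.
have ts0 : 0 <= t - s by rewrite subr_ge0.
have f1 : `|left_signature m y1 t c wl| <= (K * (t - s)) ^+ size l.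
  have := @sigT_le _ V m y1 c1 K c t wl c0 ct t1 K0 K1v.
  rewrite sl => /le_trans; apply.
  apply: lerXn2r; rewrite ?nnegrE ?mulr_ge0 ?subr_ge0 //.
  by apply: ler_wpM2l => //; rewrite lerD2l lerN2.
have f12 : `|(left_signature m y1 t c - left_signature m y2 t c) wl| <=
    (size l)%:R * eps * (K * (t - s)) ^+ size l.
  have := IH wl c; rewrite sl => /(_ ln c0 ct) /le_trans; apply.
  apply: ler_wpM2l; first by rewrite mulr_ge0.
  apply: lerXn2r; rewrite ?nnegrE ?mulr_ge0 ?subr_ge0 //.
  by apply: ler_wpM2l => //; rewrite lerD2l lerN2.
set p := (K * (t - s)) ^+ size l in f1 f12 *.
have p0 : 0 <= p by rewrite exprn_ge0 // mulr_ge0.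
apply: (@le_trans _ _ ((eps * p + K * ((size l)%:R * eps * p)) * (t - s))).
  apply: ler_wpM2r => //; apply: (le_trans (ler_normD _ _)).
  by rewrite !normrM; apply: lerD; apply: ler_pM => //; [exact: v12|exact: K2v].
rewrite exprS -/p -[(size l).+1%:R]natr1.
have -> : ((size l)%:R + 1) * eps * (K * (t - s) * p) =
  (eps * p * K + K * ((size l)%:R * eps * p)) * (t - s) by ring.
(* The replaced letter brings eps without a factor K; 1 <= K restores the power. *)
apply: ler_wpM2r => //; rewrite lerD2r; apply: ler_peMr => //.
by rewrite mulr_ge0.
Qed.

Variable N : T -> R.
Hypothesis (m0 : (0 < m)%N) (hN : homogeneous_norm (N : tensor V m -> R)).

(** In degree k >= 1 the coordinates are at most C1 eps K^k (t - s)^k. As 1 <= K and eta <= 1, the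
    condition on eta^m brings them below (eta (t - s))^k in every degree at once. *)
Lemma norm_sigT_quotient :
  exists2 C, 0 <= C & exists2 C1, 0 <= C1 & forall y1 y2 K eps eta s t,
  (forall i, continuous (velocity y1 i)) -> (forall i, continuous (velocity y2 i)) ->
  1 <= K -> 0 <= eps ->
  (forall i u, 0 <= u <= 1 -> `|velocity y1 i u| <= K) ->
  (forall i u, 0 <= u <= 1 -> `|velocity y2 i u| <= K) ->
  (forall i u, 0 <= u <= 1 -> `|velocity y1 i u - velocity y2 i u| <= eps) ->
  0 <= eta <= 1 -> C1 * eps * K ^+ m <= eta ^+ m ->
  0 <= s -> s <= t -> t <= 1 ->
  N (invT (left_signature m y1 t s) * left_signature m y2 t s) <= C * (eta * (t - s)).
Proof.
have [C C0 HC] := norm_le m0 hN ler01.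
have [c c0 hinv] := @hbounded_invT R V m 1 ler01.
exists C => //; exists ((#|word| * #|word|)%:R * (c * m%:R)).
  by rewrite !mulr_ge0.
move=> y1 y2 K eps eta s t c1 c2 K1 e0 K1v K2v v12 /andP[eta0 eta1] eK s0 st t1.
have K0 : 0 <= K by exact: le_trans K1.
have ts0 : 0 <= t - s by rewrite subr_ge0.
have Kts : 0 <= K * (t - s) by rewrite mulr_ge0.
have G1 := group_sigT c1 m0 s0 st; have G2 := group_sigT c2 m0 s0 st.
set f1 := left_signature m y1 t s in G1 *; set f2 := left_signature m y2 t s in G2 *.
have Gq : G (invT f1 * f2) by apply: groupM => //; exact: group_invT.
apply: HC => //; first by rewrite mulr_ge0.
have hf1 : hbounded f1 1 (K * (t - s)).
  by move=> w; rewrite mul1r; exact: sigT_le.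
have hf2 : hbounded (f2 - f1) (m%:R * eps) (K * (t - s)).
  move=> w; apply: le_trans (_ : (size w)%:R * eps * (K * (t - s)) ^+ size w <= _).
    by apply: sigTB_le => // i u u01; rewrite distrC; exact: v12.
  apply: ler_wpM2r; first exact: exprn_ge0.
  by apply: ler_wpM2r => //; rewrite ler_nat size_bseq.
have hq : hbounded (invT f1 * f2 - 1)
    ((#|word| * #|word|)%:R * (c * (m%:R * eps))) (K * (t - s)).
  (* The quotient minus 1 is f1^{-1} (f2 - f1). *)
  rewrite -(mulVT G1) -mulrBr; apply: hboundedM => //; first by rewrite mulr_ge0.
  exact: hinv.
move=> w; case: (posnP (size w)) => [w0|wn].
  have -> : w = [bseq] by apply: val_inj; apply/nilP; rewrite /nilp w0.
  by rewrite (group_coef0 Gq) expr0 normr1 mulr1.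
have := hq w; rewrite tadd_coef topp_coef tone_coef (gtn_eqF wn) subr0.
move=> /le_trans; apply; rewrite mul1r !exprMn [leLHS]mulrA.
apply: ler_wpM2r; first exact: exprn_ge0.
apply: (@le_trans _ _ (eta ^+ m)).
  apply: le_trans eK; rewrite -![in leRHS]mulrA -!mulrA; do 4 apply: ler_wpM2l => //.
  by rewrite ler_weXn2l // size_bseq.
by rewrite ler_wiXn2l // size_bseq.
Qed.

End SignatureDifference.

(** * Estimates for the p-variation distance *)

Section PVariation.
Context {R : realType} (V : finNormedModType R) (m : nat).
Local Notation T := (talg V m).
Local Notation G := (@free_nilpotent_group R V m : T -> Prop).
Variables (N : T -> R) (p : R).
Hypotheses (m0 : (0 < m)%N) (hN : homogeneous_norm (N : tensor V m -> R)) (p1 : 1 <= p).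
Implicit Types (X Y Z : R -> tensor V m) (D : seq R) (e : R).

Let p_gt0 : 0 < p. Proof. exact: lt_le_trans p1. Qed.
Let p_ge0 : 0 <= p. Proof. exact: ltW. Qed.

Lemma itv_partition_nth D (k : nat) : itv_partition (0 : R) 1 D -> (k < size D)%N ->
  [/\ 0 <= nth 1 (0 :: D) k, nth 1 (0 :: D) k <= nth 1 (0 :: D) k.+1
    & nth 1 (0 :: D) k.+1 <= 1].
Proof.
move=> D01 kD; split.
- by apply: itv_partition_nth_ge D01; exact: ltnW.
- by case: D01 => /(pathP 1)/(_ k kD)/ltW.
- by apply: itv_partition_nth_le D01.
Qed.

Lemma pvar_sum_ge0 X Y D : 0 <= pvar_sum N p X Y D.
Proof. by apply: sumr_ge0 => i _; exact: powR_ge0. Qed.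

Lemma pvar_sum_le X Y D e : itv_partition 0 1 D -> 0 <= e ->
  (pvar_dist N p X Y < e%:E)%E -> pvar_sum N p X Y D <= e `^ p.
Proof.
move=> D01 e0 dXY.
have : ((pvar_sum N p X Y D `^ p^-1)%:E < e%:E)%E.
  by apply: le_lt_trans dXY; apply: ereal_sup_ubound; exists D.
rewrite lte_fin => /ltW h.
have -> : pvar_sum N p X Y D = (pvar_sum N p X Y D `^ p^-1) `^ p.
  by rewrite -powRrM mulVf ?gt_eqF // powRr1 // pvar_sum_ge0.
by apply: ge0_ler_powR => //; rewrite nnegrE // powR_ge0.
Qed.

Lemma pvar_dist_le X Y e : 0 <= e ->
  (forall D, itv_partition 0 1 D -> pvar_sum N p X Y D <= e `^ p) ->
  (pvar_dist N p X Y <= e%:E)%E.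
Proof.
move=> e0 H; apply: ub_ereal_sup => _ [D D01 <-]; rewrite lee_fin.
have -> : e = (e `^ p) `^ p^-1 by rewrite -powRrM mulfV ?gt_eqF // powRr1.
apply: ge0_ler_powR; rewrite ?nnegrE ?powR_ge0 ?invr_ge0 ?pvar_sum_ge0 //.
exact: H.
Qed.

Lemma tdist_ge0 (g h : T) : G g -> G h -> 0 <= tdist N g h.
Proof.
move=> Gg Gh; apply: (norm_ge0 hN (g := invT g * h)).
by apply: groupM => //; exact: group_invT.
Qed.

Lemma tdist_sym (g h : T) : G g -> G h -> tdist N g h = tdist N h g.
Proof.
move=> Gg Gh; have Gq : G (invT g * h) by apply: groupM => //; exact: group_invT.
rewrite -[LHS](norm_invT hN Gq); congr N.
apply: invT_unique; first exact: group_coef0.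
change (invT h * g * (invT g * h) = 1).
by rewrite mulrA -[_ * g * _]mulrA mulTV // mulr1 mulVT.
Qed.

Lemma tdist_triangle (g h k : T) : G g -> G h -> G k ->
  tdist N g k <= tdist N g h + tdist N h k.
Proof.
move=> Gg Gh Gk; have -> : tdist N g k = N ((invT g * h) * (invT h * k)).
  congr N; change (invT g * k = (invT g * h) * (invT h * k)).
  by rewrite mulrA -[_ * h * _]mulrA mulTV // mulr1.
by apply: (normM hN); apply: groupM => //; exact: group_invT.
Qed.

(** The sum is at most three times its largest term; this plays the part of Minkowski's inequality,
    up to a constant. *)
Lemma powR_add3 (a b c : R) : 0 <= a -> 0 <= b -> 0 <= c ->
  (a + b + c) `^ p <= 3 `^ p * (a `^ p + b `^ p + c `^ p).
Proof.
move=> a0 b0 c0.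
have H d : 0 <= d -> a + b + c <= 3 * d -> (a + b + c) `^ p <= 3 `^ p * d `^ p.
  move=> d0 h; rewrite -powRM //; apply: ge0_ler_powR; rewrite ?nnegrE //.
  + by rewrite !addr_ge0.
  + by rewrite mulr_ge0.
have [Pa Pb Pc] : [/\ 0 <= a `^ p, 0 <= b `^ p & 0 <= c `^ p].
  by split; exact: powR_ge0.
have T0 : 0 <= 3 `^ p :> R by exact: powR_ge0.
case: (leP a b) => ab; case: (leP b c) => bc.
- by apply: le_trans (H c c0 _) _; [lra|apply: ler_wpM2l => //; lra].
- by apply: le_trans (H b b0 _) _; [lra|apply: ler_wpM2l => //; lra].
- case: (leP a c) => ac.
    by apply: le_trans (H c c0 _) _; [lra|apply: ler_wpM2l => //; lra].
  by apply: le_trans (H a a0 _) _; [lra|apply: ler_wpM2l => //; lra].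
- by apply: le_trans (H a a0 _) _; [lra|apply: ler_wpM2l => //; lra].
Qed.

(** What paths of the closure and signatures have in common, enough to apply the axioms of the norm
    to each term of a p-variation sum. *)
Definition Gincrements X := forall s t, 0 <= s -> s <= t -> t <= 1 ->
  G (increment X s t).

Lemma Gincrements_Gpath X : Gpath X -> Gincrements X.
Proof.
case=> _ GX _ s t s0 st t1.
have Gs : G (X s) by apply: GX; rewrite in_itv /= s0 (le_trans st).
have Gt : G (X t) by apply: GX; rewrite in_itv /= t1 (le_trans s0).
by apply: (groupM m0 (g := invT (X s)) (h := X t)) => //; exact: group_invT.
Qed.

(** In 9 = 3 * 3, one factor comes from [powR_add3], the other from adding three terms, as 3 <=
    3^p. *)
Lemma pvar_dist_triangle3 X1 X2 Y1 Y2 e : 0 <= e ->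
  Gincrements X1 -> Gincrements X2 -> Gincrements Y1 -> Gincrements Y2 ->
  (pvar_dist N p Y1 X1 < e%:E)%E -> (pvar_dist N p Y2 X2 < e%:E)%E ->
  (forall D, itv_partition 0 1 D -> pvar_sum N p Y1 Y2 D <= e `^ p) ->
  (pvar_dist N p X1 X2 <= (9 * e)%:E)%E.
Proof.
move=> e0 GX1 GX2 GY1 GY2 d1 d2 d12.
apply: pvar_dist_le => [|D D01]; first by rewrite mulr_ge0.
apply: (@le_trans _ _ (3 `^ p * (pvar_sum N p Y1 X1 D + pvar_sum N p Y1 Y2 D +
    pvar_sum N p Y2 X2 D))).
  rewrite /pvar_sum -!big_split mulr_sumr big_nat_cond [leRHS]big_nat_cond.
  apply: ler_sum => k; rewrite andbT => /andP[_ kD] /=.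
  have [s0 st t1] := itv_partition_nth D01 kD.
  set s := nth 1 (0 :: D) k in s0 st *; set t := nth 1 (0 :: D) k.+1 in st t1 *.
  have := GX1 _ _ s0 st t1; have := GX2 _ _ s0 st t1.
  have := GY1 _ _ s0 st t1; have := GY2 _ _ s0 st t1.
  set a := increment Y2 s t; set b := increment Y1 s t.
  set c := increment X2 s t; set d := increment X1 s t => Ga Gb Gc Gd.
  apply: le_trans (powR_add3 _ _ _); rewrite ?tdist_ge0 //.
  apply: ge0_ler_powR; rewrite ?nnegrE ?addr_ge0 ?tdist_ge0 //.
  rewrite (tdist_sym Gb Gd).
  apply: le_trans (tdist_triangle Gd Ga Gc) _.
  by rewrite lerD2r; exact: tdist_triangle.
have -> : (9 * e) `^ p = 3 `^ p * (3 `^ p * e `^ p).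
  by rewrite mulrA -!powRM //; congr ((_ * _) `^ _); ring.
apply: ler_wpM2l; first exact: powR_ge0.
apply: (@le_trans _ _ (3 * e `^ p)).
  have := pvar_sum_le D01 e0 d1; have := pvar_sum_le D01 e0 d2.
  by have := d12 D D01; lra.
apply: ler_wpM2r; first exact: powR_ge0.
rewrite -[leLHS](@powRr1 _ 3) //.
by apply: ler_powR => //; rewrite ler1n.
Qed.

Lemma telescope_partition D : itv_partition (0 : R) 1 D ->
  \sum_(0 <= k < size D) (nth 1 (0 :: D) k.+1 - nth 1 (0 :: D) k) = 1.
Proof.
move=> D01; rewrite telescope_sumr //.
by rewrite (itv_partition_nth_size _ D01) subr0.
Qed.

(** Since p >= 1 and t - s <= 1, (t - s)^p <= t - s, and the lengths add up to 1. *)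
Lemma pvar_sum_lipschitz X Y D (c : R) : itv_partition 0 1 D -> 0 <= c ->
  (forall s t, 0 <= s -> s <= t -> t <= 1 ->
    0 <= tdist N (increment X s t) (increment Y s t) <= c * (t - s)) ->
  pvar_sum N p X Y D <= c `^ p.
Proof.
move=> D01 c0 H.
apply: (@le_trans _ _ (\sum_(0 <= k < size D)
    c `^ p * (nth 1 (0 :: D) k.+1 - nth 1 (0 :: D) k))); last first.
  by rewrite -mulr_sumr telescope_partition // mulr1.
rewrite /pvar_sum big_nat_cond [leRHS]big_nat_cond.
apply: ler_sum => k; rewrite andbT => /andP[_ kD] /=.
have [s0 st t1] := itv_partition_nth D01 kD.
set s := nth 1 (0 :: D) k in s0 st *; set t := nth 1 (0 :: D) k.+1 in st t1 *.
have /andP[d0 dc] := H _ _ s0 st t1.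
have ts0 : 0 <= t - s by rewrite subr_ge0.
apply: (@le_trans _ _ ((c * (t - s)) `^ p)).
  by apply: ge0_ler_powR; rewrite ?nnegrE // mulr_ge0.
rewrite powRM //; apply: ler_wpM2l; first exact: powR_ge0.
case: (eqVneq (t - s) 0) => [->|tsn]; first by rewrite powR0 // gt_eqF.
rewrite -[leRHS]powRr1 //; apply: ger_powR => //.
by rewrite lt0r tsn ts0 /=; lra.
Qed.

End PVariation.

(** * Velocity coordinates and their encoding *)

Section SmoothPaths.
Context {R : realType} (V : finNormedModType R).
Local Notation n := (\dim {:V}).
Implicit Types (v : V) (y : R -> V) (t u : R).

Lemma vcoordB (i : 'I_n) (v v' : V) : vcoord i (v - v') = vcoord i v - vcoord i v'.
Proof. by rewrite /vcoord linearB. Qed.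

Lemma vcoordZ (i : 'I_n) (k : R) (v : V) : vcoord i (k *: v) = k * vcoord i v.
Proof. by rewrite /vcoord linearZ. Qed.

Lemma rV_norm_coord (r : 'rV[R]_n) i : `|r 0 i| <= `|r|.
Proof.
rewrite [leRHS]/Num.norm /= mx_normrE.
by apply: (le_trans _ (le_bigmax _ _ (0, i))).
Qed.

Lemma vcoord_bounded (i : 'I_n) : exists2 C, 0 < C & forall v, `|vcoord i v| <= C * `|v|.
Proof.
pose f (r : 'rV[R]_n) : V := \sum_j r 0 j *: (vbasis {:V})`_j.
have fc : continuous f.
  apply: (@continuous_big V 'I_n +%R 0); first exact: add_continuous.
  move=> j _ r.
  apply: (@cvgZr_tmp R V _ (nbhs r) _ (fun M : 'rV[R]_n => M 0 j) (r 0 j)).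
  exact: (@coord_continuous R 1 n 0 j r).
have fZ k r : f (k *: r) = k *: f r.
  by rewrite /f scaler_sumr; apply: eq_bigr => j _; rewrite mxE scalerA.
have gc : continuous (fun r => `|f r| : R).
  by move=> r; apply: continuous_comp; [exact: fc|exact: norm_continuous].
pose A := [set r : 'rV[R]_n | `|r| = 1].
have cA : compact A.
  apply: bounded_closed_compact.
    exists 1; split; first exact: num_real.
    by move=> x x1 r /= ->; exact: ltW.
  have -> : A = (fun r : 'rV[R]_n => `|r|) @^-1` [set x | x = 1] by [].
  apply: preimage_closed; last exact: closed_eq.
  by move=> r _; exact: norm_continuous.
(* The index [i] guarantees positive dimension, hence a nonempty sphere. *)
have A0 : (A !=set0)%classic.
  pose d : 'rV[R]_n := \row_j (i == j)%:R.
  have d0 : `|d| != 0.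
    rewrite normr_eq0; apply/eqP => /matrixP/(_ 0 i); rewrite !mxE eqxx.
    by move/eqP; rewrite oner_eq0.
  by exists (`|d|^-1 *: d); rewrite /A /= normrZ normfV normr_id mulVf.
have [c cA1 cmin] := EVT_min_rV A0 cA (continuous_subspaceT gc).
have c0 : 0 < `|f c|.
  rewrite normr_gt0; apply/eqP => fc0.
  have := basis_free (vbasisP {:V}) => /freeP/(_ (fun j => c 0 j) fc0) cj.
  move: cA1; rewrite inE /A /= => c1.
  have c00 : c = 0 by apply/matrixP => k j; rewrite ord1 cj mxE.
  by move/eqP: c1; rewrite c00 normr0 eq_sym oner_eq0.
exists (`|f c|^-1); first by rewrite invr_gt0.
move=> v; pose r : 'rV[R]_n := \row_j vcoord j v.
have fr : f r = v.
  rewrite [RHS](coord_vbasis (memvf v)); apply: eq_bigr => j _.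
  by rewrite mxE.
have ri : `|vcoord i v| <= `|r| by have := rV_norm_coord r i; rewrite mxE.
apply: (le_trans ri); rewrite mulrC ler_pdivlMr //.
case: (eqVneq `|r| 0) => [->|rn]; first by rewrite mul0r.
have r0 : 0 < `|r| by rewrite lt0r rn normr_ge0.
have : `|f c| <= `|f (`|r|^-1 *: r)|.
  by apply: cmin; rewrite inE /A /= normrZ normfV normr_id mulVf.
by rewrite fZ fr normrZ normfV normr_id mulrC ler_pdivlMr // mulrC.
Qed.

Lemma vcoord_continuous (i : 'I_n) : continuous (vcoord i : V -> R).
Proof.
have [C C0 HC] := vcoord_bounded i.
move=> v; apply/cvgrPdist_le => /= e e0; near=> v'.
rewrite -vcoordB; apply: (le_trans (HC _)); rewrite mulrC -ler_pdivlMr //.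
near: v'; apply: cvgr_dist_le; first exact: cvg_id.
by rewrite divr_gt0.
Unshelve. all: by end_near. Qed.

Lemma is_derive_vcoord (i : 'I_n) y t : derivable y t 1 ->
  is_derive t 1 (fun u => vcoord i (y u) : R) (vcoord i (derive1 y t)).
Proof.
move=> yt.
have H : (fun h => h^-1 *: (((fun u => vcoord i (y u) : R) \o shift t) (h *: 1) -
   vcoord i (y t))) @ 0^' --> vcoord i (derive1 y t).
  have -> : (fun h => h^-1 *: (((fun u => vcoord i (y u) : R) \o shift t) (h *: 1) -
      vcoord i (y t))) =
    vcoord i \o (fun h => h^-1 *: ((y \o shift t) (h *: 1) - y t)).
    by apply/funext => h /=; rewrite vcoordZ vcoordB.
  by rewrite derive1E; apply: continuous_cvg; [exact: vcoord_continuous|exact: yt].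
apply: DeriveDef; first by apply/cvg_ex; eexists; exact: H.
by apply/cvg_lim.
Qed.

Definition acceleration y (i : 'I_n) u : R := vcoord i (derive1 (derive1 y) u).

Lemma smooth_velocity y (i : 'I_n) u : smooth_path y ->
  is_derive u 1 (velocity y i) (acceleration y i u).
Proof. by move=> ys; apply: is_derive_vcoord; exact: (ys 1%N). Qed.

Lemma velocity_continuous y (i : 'I_n) : smooth_path y -> continuous (velocity y i).
Proof.
by move=> ys u; apply: derivable_continuous; exact: smooth_velocity.
Qed.

Lemma acceleration_continuous y (i : 'I_n) : smooth_path y ->
  continuous (acceleration y i).
Proof.
move=> ys u; apply: (@derivable_continuous _ _ (vcoord i (derive1 (derive1 (derive1 y)) u))).
by apply: is_derive_vcoord; exact: (ys 2%N).
Qed.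

Lemma continuous_bounded_unit (g : R -> R) : continuous g ->
  exists2 K, 0 <= K & forall u, 0 <= u <= 1 -> `|g u| <= K.
Proof.
move=> gc.
have ngc : {within `[0, 1]%classic, continuous (fun u => `|g u|)}.
  apply: continuous_subspaceT => u.
  by apply: continuous_comp; [exact: gc|exact: norm_continuous].
have [c _ cmax] := EVT_max ler01 ngc.
by exists `|g c| => // u u01; apply: cmax; rewrite in_itv.
Qed.

Definition velocity_bound y (K : R) : Prop :=
  (forall (i : 'I_n) u, 0 <= u <= 1 -> `|velocity y i u| <= K) /\
  (forall (i : 'I_n) u u', 0 <= u <= 1 -> 0 <= u' <= 1 ->
     `|velocity y i u - velocity y i u'| <= K * `|u - u'|).

(** The bound is an integer so that it can enter a countable code. *)
Lemma smooth_velocity_bound y : smooth_path y ->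
  exists K : nat, (0 < K)%N /\ velocity_bound y K%:R.
Proof.
move=> ys.
have H i : exists K : R, 0 <= K /\ (forall u, 0 <= u <= 1 ->
    `|velocity y i u| <= K /\ `|acceleration y i u| <= K).
  have [K1 K10 H1] := continuous_bounded_unit (velocity_continuous (i := i) ys).
  have [K2 K20 H2] := continuous_bounded_unit (acceleration_continuous (i := i) ys).
  exists (K1 + K2); split; first exact: addr_ge0.
  move=> u u01; split; first by apply: (le_trans (H1 u u01)); rewrite lerDl.
  by apply: (le_trans (H2 u u01)); rewrite lerDr.
have [K HK] := choice H.
pose B := \sum_i K i.
have KB i : K i <= B.
  by rewrite /B (bigD1 i) //= lerDl sumr_ge0 // => j _; have [] := HK j.
pose k := (Num.trunc B).+1.
have Bk : B <= k%:R by apply: ltW; exact: truncnS_gt.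
exists k; split => //; split.
  move=> i u u01; apply: le_trans Bk; apply: le_trans (KB i).
  by have [_ /(_ u u01)[]] := HK i.
move=> i.
have main u u' : 0 <= u -> u <= u' -> u' <= 1 ->
    `|velocity y i u' - velocity y i u| <= k%:R * `|u' - u|.
  move=> u0 uu u1.
  have [||c] := @MVT_segment _ (velocity y i) (acceleration y i) u u' uu.
  - by move=> x _; exact: smooth_velocity.
  - by apply: continuous_subspaceT; exact: velocity_continuous.
  rewrite in_itv /= => /andP[uc cu] ->; rewrite normrM; apply: ler_wpM2r => //.
  apply: le_trans Bk; apply: le_trans (KB i).
  have c01 : 0 <= c <= 1 by rewrite (le_trans u0) // (le_trans cu).
  by have [_ /(_ c c01)[]] := HK i.
move=> u u' /andP[u0 u1] /andP[u'0 u'1]; case: (leP u u') => uu.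
  by rewrite distrC [`|u - u'|]distrC; exact: main.
by apply: main => //; exact: ltW.
Qed.

(** One of countably many values, yet it determines the velocity up to an error of order 1/e when
    the Lipschitz constant is known. *)
Definition velocity_code y (e : nat) : seq (seq int) :=
  [seq [seq Num.floor (e%:R * velocity y i (j%:R / e%:R)) | i <- enum 'I_n]
  | j <- iota 0 e.+1].

(** The error is K/e for moving each velocity to a grid point, plus 1/e <= K/e for rounding. *)
Lemma velocity_code_close y1 y2 (K e : nat) (i : 'I_n) u :
  (0 < e)%N -> (0 < K)%N -> velocity_bound y1 K%:R -> velocity_bound y2 K%:R ->
  velocity_code y1 e = velocity_code y2 e -> 0 <= u <= 1 ->
  `|velocity y1 i u - velocity y2 i u| <= 3 * K%:R / e%:R.
Proof.
move=> e0 K0 [_ L1] [_ L2] ez /andP[u0 u1].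
have eR : 0 < e%:R :> R by rewrite ltr0n.
(* The last grid point at or before u; u = 1 gives j = e, covered by the e + 1 samples. *)
pose j := Num.trunc (e%:R * u).
have /andP[jl ju] : j%:R <= e%:R * u < j.+1%:R.
  by apply: truncn_itv; rewrite mulr_ge0.
have je : (j <= e)%N.
  rewrite -(ler_nat R); apply: (le_trans jl).
  by rewrite -[leRHS]mulr1 ler_wpM2l.
pose q : R := j%:R / e%:R.
have q01 : 0 <= q <= 1 by rewrite divr_ge0 //= ler_pdivrMr // mul1r ler_nat.
have uq : `|u - q| <= e%:R^-1.
  have -> : u - q = (e%:R * u - j%:R) / e%:R.
    by rewrite mulrBl mulrAC mulfV ?gt_eqF // mul1r.
  rewrite normrM normfV (gtr0_norm eR) ger0_norm ?subr_ge0 //.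
  have eu1 : e%:R * u - j%:R <= 1 by rewrite -natr1 in ju; lra.
  by rewrite ler_piMl // invr_ge0 ltW.
have K1 : 1 <= K%:R :> R by rewrite ler1n.
have fl : Num.floor (e%:R * velocity y1 i q) = Num.floor (e%:R * velocity y2 i q).
  have jm : j \in iota 0 e.+1 by rewrite mem_iota add0n ltnS je.
  have /eq_in_map/(_ j jm) := ez.
  by move/eq_in_map/(_ i (mem_enum _ i)).
have vq : `|velocity y1 i q - velocity y2 i q| <= e%:R^-1.
  have /andP[a1 b1] := floor_itv (e%:R * velocity y1 i q).
  have /andP[a2 b2] := floor_itv (e%:R * velocity y2 i q).
  rewrite fl in a1 b1; rewrite intrD in b1 b2.
  rewrite -(ler_pM2l eR) mulfV ?gt_eqF // -[X in X * _ <= _](gtr0_norm eR) -normrM.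
  by rewrite mulrBr ler_norml; apply/andP; split; lra.
have Ke (d : R) : d <= e%:R^-1 -> K%:R * d <= K%:R * e%:R^-1.
  by move=> de; apply: ler_wpM2l.
have u01 : 0 <= u <= 1 by rewrite u0.
have l1 := le_trans (L1 i u q u01 q01) (Ke `|u - q| uq).
have l2 := le_trans (L2 i u q u01 q01) (Ke `|u - q| uq).
have eK : e%:R^-1 <= K%:R * e%:R^-1 :> R by rewrite ler_peMl ?invr_ge0.
rewrite -mulrA; set z := K%:R * e%:R^-1 in l1 l2 eK *.
move: l1 l2 vq; rewrite !ler_norml => /andP[? ?] /andP[? ?] /andP[? ?].
by apply/andP; split; lra.
Qed.

End SmoothPaths.

(** * The countable dense set indexed by codes *)

Theorem theorem23 (R : realType) (V : finNormedModType R) (m : nat)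
    (N : tensor V m -> R) (p : R) (hm : (1 <= m)%N) (hN : homogeneous_norm N)
    (hp : 1 <= p) :
  separable (pvar_dist N p) (C0pvar N p).
Proof.
have [C C0 [C1 C10 HC]] := norm_sigT_quotient hm hN.
(* Precision 1/(n+1) of the approximation, velocity bound K, mesh 1/e, and sampled velocities. *)
pose code : countType := (nat * nat * nat * seq (seq int))%type.
pose matches (c : code) (Y : R -> tensor V m) := let: (n, K, e, z) := c in
  C0pvar N p Y /\ exists y : R -> V,
    [/\ smooth_path y, (pvar_dist N p (signature m y 0%R) Y < (n.+1%:R^-1)%:E)%E,
        velocity_bound y K%:R & z = velocity_code y e].
pose rep (c : code) := xget (fun=> 0%R) (matches c).
(* Codes matched by no path are discarded, as [rep] takes a default value there. *)
exists (rep @` [set c | matches c (rep c)]).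
  split; first exact: (sub_countable (card_image_le _ _) (countableP _)).
  by move=> _ [[[[n K] e] z] /= [? _] <-].
move=> Y YC eps eps0.
(* The triangle inequality will give 9 eta; dividing by 10 makes the final bound strict. *)
pose eta : R := Num.min 1 (eps / 10).
have eta0 : 0 < eta by rewrite /eta lt_min ltr01 divr_gt0.
have eta1 : eta <= 1 by rewrite /eta ge_min lexx.
have eta_eps : 9 * eta < eps.
  have : eta <= eps / 10 by rewrite /eta ge_min lexx orbT.
  by lra.
(* C + 1 is positive even if C = 0, and gives both C d <= eta and d <= 1. *)
pose d := eta / (C + 1).
have Cp : 0 < C + 1 by lra.
have d0 : 0 < d by rewrite divr_gt0.
have dE : (C + 1) * d = eta by rewrite /d mulrC divfK // gt_eqF.
have Cd : C * d <= eta by rewrite -dE mulrDl mul1r lerDl ltW.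
have d1 : d <= 1.
  by apply: le_trans eta1; rewrite -dE mulrDl mul1r lerDr mulr_ge0 // ltW.
pose n := Num.trunc (eta^-1).
have n_eta : n.+1%:R^-1 <= eta.
  by rewrite -[leRHS]invrK lef_pV2 ?posrE ?invr_gt0 // ltW // truncnS_gt.
have [YG Yapp] := YC.
have [|y ys yY] := Yapp n.+1%:R^-1; first by rewrite invr_gt0.
have [K [K0 yK]] := smooth_velocity_bound ys.
(* B <= e is the condition C1 eps K^m <= d^m of [norm_sigT_quotient] for eps = 3K/e. *)
pose B := C1 * (3 * K%:R) * K%:R ^+ m / d ^+ m.
have B0 : 0 <= B by rewrite divr_ge0 ?mulr_ge0 ?exprn_ge0 // ltW.
pose e := (Num.trunc B).+1.
have Be : B <= e%:R by rewrite ltW // truncnS_gt.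
have eR : 0 < e%:R :> R by rewrite ltr0n.
pose c : code := (n, K, e, velocity_code y e).
(* [Y] itself matches its code, so the representative is a genuine one. *)
have : matches c (rep c) by apply: xgetI (Y) _; split => //; exists y.
move=> mc; have [[ZG _] [y' [y's yZ y'K zE]]] := mc.
exists (rep c); first by exists c.
apply: (@le_lt_trans _ _ (9 * eta)%:E); last by rewrite lte_fin.
have c1 i := velocity_continuous (i := i) ys.
have c2 i := velocity_continuous (i := i) y's.
have Gsig x : smooth_path x -> Gincrements (signature m x 0).
  move=> xs s t s0 st t1; have xc i := velocity_continuous (i := i) xs.
  by rewrite increment_signature //; exact: group_sigT.
have n_etaE : ((n.+1%:R^-1)%:E <= eta%:E :> \bar R)%E by rewrite lee_fin.
apply: (@pvar_dist_triangle3 R V m N p hm hN hp Y (rep c) (signature m y 0)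
  (signature m y' 0) eta (ltW eta0)).
- exact: (Gincrements_Gpath hm).
- exact: (Gincrements_Gpath hm).
- exact: Gsig.
- exact: Gsig.
- exact: lt_le_trans yY n_etaE.
- exact: lt_le_trans yZ n_etaE.
move=> D D01; apply: (@le_trans _ _ ((C * d) `^ p)); last first.
  apply: ge0_ler_powR; rewrite ?nnegrE //; last exact: ltW.
  + by lra.
  + by rewrite mulr_ge0 // ltW.
apply: (pvar_sum_lipschitz hp D01); first by rewrite mulr_ge0 // ltW.
move=> s t s0 st t1; rewrite !increment_signature //.
have G1 := group_sigT c1 hm s0 st; have G2 := group_sigT c2 hm s0 st.
rewrite (tdist_ge0 hm hN G1 G2) /= -mulrA.
apply: (HC y y' K%:R (3 * K%:R / e%:R) d s t) => //.
- by rewrite ler1n.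
- by case: yK.
- by case: y'K.
- by move=> i u; apply: velocity_code_close.
- by rewrite d1 ltW.
move: Be; rewrite /B ler_pdivrMr ?exprn_gt0 // => Be.
rewrite mulrA mulrAC ler_pdivrMr //.
by rewrite [leRHS]mulrC.
Qed.
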